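(* Let $\varepsilon=1/N$, $x=yN$, $n=zN$ and $y=Y^{-}(z)-\beta\varepsilon^{2/3}$. For $0<z<p$ and $\beta=O(1)$, as $N\to\infty$, $$K_n(x)\sim\varepsilon^{1/3}\exp\left[\varepsilon^{-1}\psi_0(z)+\ln\left(\frac{U_0+p}{U_0-q}\right)\beta\varepsilon^{-1/3}\right]\mathrm{Ai}\left(\Theta^{2/3}\beta\right)\frac{\Theta^{-1/3}}{\sqrt{zU_0}},$$ where $U_0=U_0(z)$ and $\Theta=\Theta(z)$.
   Context: Fix real $0<p,q<1$ with $p+q=1$. For integers $n,N\ge 0$ and real $x$, the Krawtchouk polynomial is $$K_n(x)=K_n(x,N,p,q)=\sum_{k=0}^{n}\binom{x}{k}\binom{N-x}{n-k}q^{k}(-p)^{n-k},$$ where $\binom{a}{k}=a(a-1)\cdots(a-k+1)/k!$ for real $a$ and integer $k\geq 0$. For $0<z<1$ put $$U_0(z)=\sqrt{\frac{pq(1-z)}{z}},\qquad Y^{-}(z)=p+(q-p)z-2zU_0(z),$$ $$\psi_0(z)=z\pi\mathrm{i}+(z-1)\ln(U_0)+Y^{-}(z)\ln(U_0-q)+\left[1-Y^{-}(z)\right]\ln(U_0+p),$$ $$\Theta(z)=\sqrt{\frac{U_0}{z}}\,\frac{1}{(U_0+p)(U_0-q)}$$ (for $0<z<p$ one has $U_0>q$, so the logarithms are real and $\Theta>0$). $\mathrm{Ai}$ is the Airy function.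
   Formalization: Because Ai has negative zeros, ''~'' is stated as: K_n(x) equals the prefactor times (Ai(Θ^{2/3}β)+o(1)) for all bounded β, and the ratio of both sides tends to 1 where |Ai(Θ^{2/3}β)| is bounded away from 0; both uniformly for z in compact subsets of (0,p). *)

(* Defs.v *)
From Stdlib Require Import Arith Factorial Reals.
From Coquelicot Require Import Coquelicot.

Open Scope R_scope.

Fixpoint falling (a : R) (k : nat) : R :=
  match k with
  | O => 1
  | S j => falling a j * (a - INR j)
  end.

(** Binomial coefficient with a real upper argument; Stdlib's [Binomial.C]
    only allows a natural one. *)
Definition gbinom (a : R) (k : nat) : R := falling a k / INR (fact k).

Definition krawtchouk (n : nat) (x : R) (N : nat) (p q : R) : R :=
  sum_f_R0
    (fun k => gbinom x k * gbinom (INR N - x) (n - k) * q ^ k * (- p) ^ (n - k))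
    n.

(** Airy's integral [Ai x = (1/pi) * int_0^oo cos (t^3/3 + x t) dt]; it is only
    conditionally convergent, and [RInt_gen] denotes the improper integral. *)
Definition Airy (x : R) : R :=
  / PI * RInt_gen (fun t : R => cos (t ^ 3 / 3 + x * t))
                  (at_point 0) (Rbar_locally p_infty).

Definition Cexp (w : C) : C := (exp (Re w) * cos (Im w), exp (Re w) * sin (Im w)).

Definition U0 (p q z : R) : R := sqrt (p * q * (1 - z) / z).

Definition Yminus (p q z : R) : R := p + (q - p) * z - 2 * z * U0 p q z.

(** The logarithms are real ones: [U0 p q z > q > 0] when [0 < z < p]. *)
Definition psi0 (p q z : R) : C :=
  Cplus (Cmult (RtoC (z * PI)) Ci)
    (RtoC ((z - 1) * ln (U0 p q z)
           + Yminus p q z * ln (U0 p q z - q)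
           + (1 - Yminus p q z) * ln (U0 p q z + p))).

Definition Theta (p q z : R) : R :=
  sqrt (U0 p q z / z) * / ((U0 p q z + p) * (U0 p q z - q)).

(** The factor multiplying [Ai (Theta^(2/3) * beta)] in the approximation. *)
Definition amplitude (p q z beta eps : R) : C :=
  Cmult
    (Cmult (RtoC (Rpower eps (1 / 3)))
       (Cexp (Cplus (Cmult (RtoC (/ eps)) (psi0 p q z))
                (RtoC (ln ((U0 p q z + p) / (U0 p q z - q))
                       * beta * Rpower eps (- (1 / 3)))))))
    (RtoC (Rpower (Theta p q z) (- (1 / 3)) / sqrt (z * U0 p q z))).

(* Main.v *)
Require Import Defs.
From Stdlib Require Import Reals.
From Coquelicot Require Import Coquelicot.
From Stdlib Require Import Lra Lia Psatz.

Open Scope R_scope.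

(** The Krawtchouk polynomials have the generating function
    sum_n K_n(x) w^n = (1 + q w)^x (1 - p w)^(N - x), whose coefficient integral
    has a double saddle point at w = -1/U0 when x/N = Yminus(z).  Substituting
    w = v / (1 + p v) gives K_n(x) = [v^n] (1 + v)^x (1 + p v)^(-M) with
    M = N - n + 1 ([krawtchouk_negative_binomial]), and the saddle moves to
    v = -r with r = 1/(U0 + p).  Since U0 > q, r < 1, so the circle |v| = r through
    the saddle lies where both binomial series converge, and the coefficient
    is an integral over this circle without any branch cut or deformation
    of contours ([krawtchouk_contour_integral]).

    On v = -r e^(i t) the integrand is exp(L) cos(phi), with L and phi' functions
    of s = 1 - cos t.  At the double saddle L has a maximum at t = 0, flat to
    fourth order, and phi is a cubic to leading order; the shift of x/N by
    beta N^(-2/3) adds a linear term to phi.  With lam = N^(1/3) the integral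
    over [0, PI] splits into three ranges ([airy_asymptotics]):
    - for t <= T/lam the integrand is uniformly close to the truncated Airy
      integrand in the variable lam t;
    - from T/lam to a fixed angle L decreases and phi' is positive and
      increasing, so that oscillation bounds the contribution by a multiple
      of 1/(lam T^2) ([oscillatory_bound]);
    - beyond that angle L <= - const N.
    The tail of the Airy integral itself is controlled by the same oscillatory
    bound ([airy_truncation]).  All estimates are explicit in the parameters,
    whence uniformity in z and beta ([saddle_asymptotics]).

    The value of exp(L) r^(-n) at t = 0 is exp(psi0/eps + ...) (U0 + p)/U0 up to
    the sign (-1)^n = exp(i PI n) ([krawtchouk_saddle_form]), and the cubic
    coefficient is k^3/3 for a k with k Theta^(2/3) = 1/(U0 - q)
    ([airy_scale_facts]); these two identities give the amplitude and the
    argument of Ai. *)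

(** * Calculus *)

Lemma le_scale_up : forall l a, 1 <= l -> 0 <= a -> a <= l * a.
Proof. intros l a Hl Ha; nra. Qed.

Lemma exp_nondecreasing : forall x y, x <= y -> exp x <= exp y.
Proof. intros x y [H| ->]; [apply Rlt_le, exp_increasing, H|apply Rle_refl]. Qed.

Lemma mean_value_bound : forall (f df : R -> R) r b, 0 <= r ->
  (forall t, 0 <= t <= r -> is_derive f t (df t)) ->
  (forall t, 0 <= t <= r -> Rabs (df t) <= b) ->
  Rabs (f r - f 0) <= b * r.
Proof.
  intros f df r b Hr Hd Hb.
  destruct (MVT_gen f 0 r df) as [c [Hc He]];
    rewrite ?(Rmin_left 0 r), ?(Rmax_right 0 r) in * by lra.
  - intros; apply Hd; lra.
  - intros t Ht; apply derivable_continuous_pt; exists (df t).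
    apply is_derive_Reals, Hd, Ht.
  - rewrite He, Rabs_mult, (Rabs_pos_eq (r - 0)), Rminus_0_r by lra.
    apply Rmult_le_compat_r; [lra|apply Hb, Hc].
Qed.

Lemma mean_value_le : forall (f df : R -> R) a b c, a <= b ->
  (forall t, a <= t <= b -> is_derive f t (df t)) ->
  (forall t, a <= t <= b -> df t <= c) -> f b - f a <= c * (b - a).
Proof.
  intros f df a b c Hab Hd Hb.
  destruct (MVT_gen f a b df) as [t [Ht He]];
    rewrite ?(Rmin_left a b), ?(Rmax_right a b) in * by lra.
  - intros; apply Hd; lra.
  - intros t Ht; apply derivable_continuous_pt; exists (df t).
    apply is_derive_Reals, Hd, Ht.
  - rewrite He; apply Rmult_le_compat_r; [lra|apply Hb, Ht].
Qed.

Lemma ex_RInt_of_continuous : forall (f : R -> R) a b,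
  (forall t, continuous f t) -> ex_RInt f a b.
Proof. intros f a b Hf; apply (ex_RInt_continuous (V := R_CompleteNormedModule)); intros; apply Hf. Qed.

Lemma RInt_Chasles_R : forall (f : R -> R) a b c, (forall t, continuous f t) ->
  RInt f a c = RInt f a b + RInt f b c.
Proof.
  intros f a b c Hf; symmetry.
  apply (RInt_Chasles (V := R_CompleteNormedModule)); apply ex_RInt_of_continuous, Hf.
Qed.

Lemma is_derive_RInt_of_continuous : forall (f : R -> R) a t,
  (forall t, continuous f t) -> is_derive (RInt f a) t (f t).
Proof.
  intros f a t Hf; apply (is_derive_RInt f (RInt f a) a); [|apply Hf].
  apply filter_forall; intros s; apply (RInt_correct (V := R_CompleteNormedModule)).
  apply ex_RInt_of_continuous, Hf.
Qed.

(** The mean value theorem for G - RInt f u, whose derivative is g - f. *)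
Lemma RInt_le_primitive : forall (f G g : R -> R) u v, u <= v ->
  (forall t, continuous f t) ->
  (forall t, u <= t <= v -> is_derive G t (g t)) ->
  (forall t, u <= t <= v -> f t <= g t) ->
  RInt f u v <= G v - G u.
Proof.
  intros f G g u v Huv Hf HG Hle.
  destruct (MVT_gen (fun t => G t - RInt f u t) u v (fun t => g t - f t)) as [c [Hc He]];
    rewrite ?(Rmin_left u v), ?(Rmax_right u v) in * by lra.
  - intros t Ht; apply (is_derive_minus G (RInt f u) t).
    apply HG; lra. apply is_derive_RInt_of_continuous, Hf.
  - intros t Ht; apply derivable_continuous_pt; exists (g t - f t).
    apply is_derive_Reals, (is_derive_minus G (RInt f u) t).
    apply HG; lra. apply is_derive_RInt_of_continuous, Hf.
  - rewrite RInt_point in He; change (zero : R) with 0 in He.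
    assert (0 <= (g c - f c) * (v - u))
      by (apply Rmult_le_pos; [specialize (Hle c Hc)|]; lra).
    lra.
Qed.

Lemma RInt_dist_le : forall (f g : R -> R) a b e, a <= b ->
  (forall t, continuous f t) -> (forall t, continuous g t) ->
  (forall t, a <= t <= b -> Rabs (f t - g t) <= e) ->
  Rabs (RInt f a b - RInt g a b) <= (b - a) * e.
Proof.
  intros f g a b e Hab Hf Hg He.
  assert (Em : RInt (fun t => f t - g t) a b = RInt f a b - RInt g a b).
  { apply (RInt_minus (V := R_CompleteNormedModule) f g); apply ex_RInt_of_continuous; assumption. }
  rewrite <- Em; apply abs_RInt_le_const; [exact Hab| |exact He].
  apply (ex_RInt_minus (V := R_NormedModule) f g); apply ex_RInt_of_continuous; assumption.
Qed.

(** For w decreasing, w' (sin Phi - 1) >= 0, so f <= (w (sin Phi - 1))', and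
    likewise f >= (w (sin Phi + 1))'; integrating these two bounds replaces an
    integration by parts. *)
Lemma oscillatory_bound : forall (f w dw Phi dPhi : R -> R) u v, u <= v ->
  (forall t, continuous f t) ->
  (forall t, u <= t <= v -> is_derive w t (dw t)) ->
  (forall t, u <= t <= v -> is_derive Phi t (dPhi t)) ->
  (forall t, u <= t <= v -> dw t <= 0) ->
  (forall t, u <= t <= v -> f t = w t * dPhi t * cos (Phi t)) ->
  0 <= w u -> 0 <= w v ->
  Rabs (RInt f u v) <= 2 * w u.
Proof.
  intros f w dw Phi dPhi u v Huv Hf Hw HPhi Hdw Hfe Hu Hv.
  assert (Hder : forall c t, u <= t <= v ->
    is_derive (fun t => w t * (sin (Phi t) + c)) t
      (dw t * (sin (Phi t) + c) + w t * (dPhi t * cos (Phi t)))).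
  { intros c t Ht; specialize (Hw t Ht); specialize (HPhi t Ht).
    evar_last.
    - apply (is_derive_mult w (fun t => sin (Phi t) + c)); [exact Hw | | intros; apply Rmult_comm].
      apply (is_derive_plus (fun t => sin (Phi t)) (fun _ => c)).
      apply (is_derive_comp sin Phi); [apply is_derive_sin | exact HPhi].
      apply is_derive_const.
    - unfold plus, mult, scal, zero; simpl; unfold mult; simpl; ring. }
  assert (H1 := RInt_le_primitive f _ _ u v Huv Hf (Hder (-1))).
  assert (H2 := RInt_le_primitive (fun t => - f t) (fun t => - (w t * (sin (Phi t) + 1)))
    (fun t => - (dw t * (sin (Phi t) + 1) + w t * (dPhi t * cos (Phi t)))) u v Huv).
  lapply H1; [clear H1; intro H1|].
  lapply H2; [clear H2; intro H2|].
  lapply H2; [clear H2; intro H2|].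
  lapply H2; [clear H2; intro H2|].
  - rewrite (RInt_opp (V := R_CompleteNormedModule) f) in H2
      by (apply ex_RInt_of_continuous, Hf).
    unfold opp in H2; simpl in H2; simpl in H1.
    assert (Su := SIN_bound (Phi u)); assert (Sv := SIN_bound (Phi v)).
    apply Rabs_le; split; nra.
  - intros t Ht; rewrite Hfe by exact Ht.
    specialize (Hdw t Ht); assert (St := SIN_bound (Phi t)); nra.
  - intros t Ht; apply (is_derive_opp (fun t => w t * (sin (Phi t) + 1))), Hder, Ht.
  - intros t; apply (continuous_opp f), Hf.
  - intros t Ht; simpl; rewrite Hfe by exact Ht.
    specialize (Hdw t Ht); assert (St := SIN_bound (Phi t)); nra.
Qed.

Lemma sin_le_id : forall x, 0 <= x -> sin x <= x.
Proof. intros x [H| <-]; [apply Rlt_le, sin_lt_x, H|rewrite sin_0; lra]. Qed.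

Lemma one_minus_cos : forall x, 1 - cos x = 2 * sin (x / 2) ^ 2.
Proof.
  intros x; replace x with (2 * (x / 2)) at 1 by field.
  rewrite cos_2a_sin; ring.
Qed.

Lemma one_minus_cos_upper : forall x, 0 <= x <= 1 -> 1 - cos x <= x ^ 2 / 2.
Proof.
  intros x Hx; rewrite one_minus_cos.
  assert (H1 := sin_le_id (x / 2) ltac:(lra)).
  assert (H2 : 0 <= sin (x / 2)).
  { apply sin_ge_0; [lra|]; assert (H := PI2_1); lra. }
  nra.
Qed.

(** From sin y >= y - y^3/6 at y = x/2, squared. *)
Lemma one_minus_cos_lower : forall x, 0 <= x <= 1 -> x ^ 2 / 2 - x ^ 4 / 24 <= 1 - cos x.
Proof.
  intros x Hx; rewrite one_minus_cos.
  assert (H : x / 2 - (x / 2) ^ 3 / 6 <= sin (x / 2)).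
  { assert (D := mean_value_le (fun t => t - t ^ 3 / 6 - sin t)
      (fun t => 1 - t ^ 2 / 2 - cos t) 0 (x / 2) 0 ltac:(lra)).
    assert (D1 : x / 2 - (x / 2) ^ 3 / 6 - sin (x / 2) - (0 - 0 ^ 3 / 6 - sin 0) <= 0 * (x / 2 - 0)).
    { apply D; [intros t Ht; auto_derive; [trivial|field]|].
      intros t Ht; assert (U := one_minus_cos_upper t ltac:(lra)); lra. }
    rewrite sin_0 in D1; lra. }
  assert (Hp : 0 <= x / 2 - (x / 2) ^ 3 / 6) by nra.
  assert (E : (x / 2 - (x / 2) ^ 3 / 6) ^ 2 <= sin (x / 2) ^ 2)
    by (apply pow_incr; split; assumption).
  assert (0 <= x ^ 6) by (apply pow_le; lra).
  nra.
Qed.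

Lemma one_minus_cos_quarter : forall x, 0 <= x <= 1 -> x ^ 2 / 4 <= 1 - cos x.
Proof.
  intros x Hx; assert (L := one_minus_cos_lower x Hx).
  assert (0 <= x ^ 2 <= 1) by nra; nra.
Qed.

Lemma exp_minus_one_bound : forall g, Rabs g <= / 2 -> Rabs (exp g - 1) <= 2 * Rabs g.
Proof.
  intros g Hg.
  assert (H1 := exp_ineq1_le g); assert (H2 := exp_ineq1_le (- g)).
  assert (H3 : exp g * exp (- g) = 1) by (rewrite <- exp_plus, Rplus_opp_r; apply exp_0).
  assert (H4 := exp_pos g); assert (Hb := Hg); apply Rabs_le_between in Hb.
  unfold Rabs in *; destruct (Rcase_abs g); destruct (Rcase_abs (exp g - 1)); nra.
Qed.

Lemma cos_lipschitz : forall a b, Rabs (cos a - cos b) <= Rabs (a - b).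
Proof.
  intros a b; rewrite form2, !Rabs_mult, Rabs_left by lra.
  assert (H : Rabs (sin ((a - b) / 2)) <= Rabs ((a - b) / 2)).
  { assert (P : forall y, 0 <= y -> Rabs (sin y) <= y).
    { intros y Hy; destruct (Rle_lt_dec y 1) as [H1|H1].
      - rewrite Rabs_pos_eq; [apply sin_le_id, Hy|].
        apply sin_ge_0; [lra|]; assert (H := PI2_1); lra.
      - assert (S := SIN_bound y); apply Rabs_le; lra. }
    unfold Rabs at 2; destruct (Rcase_abs ((a - b) / 2)) as [L|L].
    - rewrite <- (Rabs_Ropp (sin _)), <- sin_neg; apply P; lra.
    - apply P; lra. }
  assert (S : Rabs (sin ((a + b) / 2)) <= 1) by (apply Rabs_le, SIN_bound).
  unfold Rdiv at 2 in H; rewrite Rabs_mult, (Rabs_pos_eq (/ 2)) in H by lra.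
  assert (Z1 := Rabs_pos (sin ((a - b) / 2))); assert (Z2 := Rabs_pos (sin ((a + b) / 2))).
  nra.
Qed.

Lemma Rabs_mult_le : forall a b x y, Rabs a <= x -> Rabs b <= y -> Rabs (a * b) <= x * y.
Proof. intros; rewrite Rabs_mult; apply Rmult_le_compat; auto using Rabs_pos. Qed.

Lemma Rabs_plus_le : forall a b x y, Rabs a <= x -> Rabs b <= y -> Rabs (a + b) <= x + y.
Proof. intros; eapply Rle_trans; [apply Rabs_triang|lra]. Qed.

Lemma Rabs_minus_le : forall a b x y, Rabs a <= x -> Rabs b <= y -> Rabs (a - b) <= x + y.
Proof. intros; apply Rabs_plus_le; [|rewrite Rabs_Ropp]; assumption. Qed.

(** * Airy's integral *)

Definition airy_integrand (x t : R) : R := cos (t ^ 3 / 3 + x * t).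

Lemma airy_integrand_continuous : forall x t, continuous (airy_integrand x) t.
Proof.
  intros x t; apply (ex_derive_continuous (airy_integrand x) t).
  unfold airy_integrand; auto_derive; trivial.
Qed.

(** [oscillatory_bound] with phase t^3/3 + x t and w = 1/(t^2 + x). *)
Lemma airy_integral_tail : forall x X T T', 0 < T -> T <= T' -> Rabs x <= X -> X < T ^ 2 ->
  Rabs (RInt (airy_integrand x) T T') <= 2 / (T ^ 2 - X).
Proof.
  intros x X T T' HT HTT Hx HX; apply Rabs_le_between in Hx.
  assert (Hpos : forall t, T <= t <= T' -> T ^ 2 - X <= t ^ 2 + x) by (intros; nra).
  apply Rle_trans with (2 * / (T ^ 2 + x)).
  - apply (oscillatory_bound (airy_integrand x) (fun t => / (t ^ 2 + x))
      (fun t => - (2 * t) / (t ^ 2 + x) ^ 2) (fun t => t ^ 3 / 3 + x * t)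
      (fun t => t ^ 2 + x)).
    + exact HTT.
    + apply airy_integrand_continuous.
    + intros t Ht; specialize (Hpos t Ht); auto_derive; [lra|field; lra].
    + intros t Ht; auto_derive; [trivial|field].
    + intros t Ht; specialize (Hpos t Ht).
      assert (0 < / (t ^ 2 + x) ^ 2) by (apply Rinv_0_lt_compat, pow_lt; lra).
      unfold Rdiv; nra.
    + intros t Ht; specialize (Hpos t Ht); unfold airy_integrand; field; lra.
    + apply Rlt_le, Rinv_0_lt_compat; specialize (Hpos T); lra.
    + apply Rlt_le, Rinv_0_lt_compat; specialize (Hpos T'); lra.
  - unfold Rdiv; apply Rmult_le_compat_l; [lra|].
    apply Rinv_le_contravar; [lra|apply Hpos; lra].
Qed.

Lemma airy_integral_limit : forall x, exists l,
  filterlim (RInt (airy_integrand x) 0) (Rbar_locally p_infty) (locally l).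
Proof.
  intros x; apply (filterlim_locally_cauchy (U := R_CompleteSpace)); intros eps.
  set (T := 1 + Rabs x + 4 / eps).
  assert (He := cond_pos eps).
  assert (H4 : 0 < 4 / eps) by (apply Rdiv_lt_0_compat; lra).
  assert (Hx := Rabs_pos x).
  assert (Hlt : 2 / (T ^ 2 - Rabs x) < eps).
  { apply Rle_lt_trans with (2 / (4 / eps)).
    - unfold Rdiv at 1 2; apply Rmult_le_compat_l; [lra|].
      apply Rinv_le_contravar; [exact H4|]; unfold T; nra.
    - replace (2 / (4 / eps)) with (eps / 2) by (field; lra); lra. }
  assert (Hc : forall u v, T < u -> u <= v ->
    Rabs (RInt (airy_integrand x) 0 v - RInt (airy_integrand x) 0 u) < eps).
  { intros u v Hu Hv.
    rewrite (RInt_Chasles_R _ 0 u v) by apply airy_integrand_continuous.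
    rewrite Rplus_comm; unfold Rminus; rewrite Rplus_assoc, Rplus_opp_r, Rplus_0_r.
    eapply Rle_lt_trans; [|exact Hlt].
    eapply Rle_trans; [apply (airy_integral_tail x (Rabs x) u v); unfold T in *; try lra; nra|].
    unfold Rdiv; apply Rmult_le_compat_l; [lra|].
    apply Rinv_le_contravar; unfold T in *; nra. }
  exists (fun u => T < u); split.
  - exists T; intros; assumption.
  - intros u v Hu Hv; unfold ball; simpl; unfold AbsRing_ball, abs, minus, plus, opp; simpl.
    destruct (Rle_lt_dec u v) as [H|H].
    + apply Hc; assumption.
    + rewrite <- Rabs_Ropp.
      rewrite Ropp_plus_distr, Ropp_involutive, Rplus_comm.
      apply Hc; lra.
Qed.

(** Passes from the improper integral in [Airy] to a proper one with an error
    that is uniform for x in a bounded set. *)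
Lemma airy_truncation : forall x X T, 0 < T -> Rabs x <= X -> X < T ^ 2 ->
  Rabs (RInt (airy_integrand x) 0 T - PI * Airy x) <= 2 / (T ^ 2 - X).
Proof.
  intros x X T HT Hx HX.
  destruct (airy_integral_limit x) as [l Hl].
  assert (HA : PI * Airy x = l).
  { unfold Airy; rewrite (is_RInt_gen_unique _ l); [field; apply PI_neq0|].
    intros P HP.
    apply (Filter_prod _ _ _ (fun a => a = 0) (fun b => P (RInt (airy_integrand x) 0 b)));
      [reflexivity | exact (Hl P HP) |].
    intros a b -> Hb; exists (RInt (airy_integrand x) 0 b); split; [|exact Hb].
    apply (RInt_correct (V := R_CompleteNormedModule)).
    apply (ex_RInt_of_continuous (airy_integrand x)), airy_integrand_continuous. }
  rewrite HA; apply le_epsilon; intros e He.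
  destruct (Hl (ball l (mkposreal e He)) (locally_ball l _)) as [S HS].
  set (S' := Rmax S T + 1).
  assert (HS1 : S < S') by (unfold S'; assert (A := Rmax_l S T); lra).
  assert (HS2 : T <= S') by (unfold S'; assert (A := Rmax_r S T); lra).
  specialize (HS S' HS1); unfold ball in HS; simpl in HS.
  unfold AbsRing_ball, abs, minus, plus, opp in HS; simpl in HS.
  assert (Ht := airy_integral_tail x X T S' HT HS2 Hx HX).
  rewrite (RInt_Chasles_R _ 0 T S') in HS by apply airy_integrand_continuous.
  apply Rabs_def2 in HS; apply Rabs_le_between in Ht.
  apply Rabs_le; lra.
Qed.

(** Brings the cubic phase of the saddle to the normal form of Airy's
    integral by u = k lam t. *)
Lemma airy_rescaling : forall k b lam T, 0 < k -> 0 < lam ->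
  lam * RInt (fun t => cos (k ^ 3 * lam ^ 3 * t ^ 3 / 3 + b * lam * t)) 0 (T / lam)
  = / k * RInt (airy_integrand (b / k)) 0 (k * T).
Proof.
  intros k b lam T Hk Hl.
  assert (E := RInt_comp_lin (V := R_CompleteNormedModule) (airy_integrand (b / k)) (k * lam) 0 0 (T / lam)).
  replace (k * lam * 0 + 0) with 0 in E by ring.
  replace (k * lam * (T / lam) + 0) with (k * T) in E by (field; lra).
  rewrite <- E by (apply ex_RInt_of_continuous, airy_integrand_continuous).
  set (h := fun t => cos (k ^ 3 * lam ^ 3 * t ^ 3 / 3 + b * lam * t)).
  rewrite (RInt_ext (fun y => scal (k * lam) _) (fun t => scal (k * lam) (h t))).
  - rewrite (RInt_scal (V := R_CompleteNormedModule) h).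
    + unfold scal; simpl; unfold mult; simpl; field; lra.
    + apply ex_RInt_of_continuous; intros t; apply (ex_derive_continuous h).
      unfold h; auto_derive; trivial.
  - intros t _; unfold airy_integrand, h; do 2 f_equal; field; lra.
Qed.

(** * Krawtchouk polynomials as coefficients of (1+v)^x (1+pv)^(-M) *)

Lemma gbinom_S : forall a k, gbinom a (S k) * INR (S k) = gbinom a k * (a - INR k).
Proof.
  intros a k; unfold gbinom; cbn [falling]; rewrite fact_simpl, mult_INR.
  field; split; [apply INR_fact_neq_0 | apply not_0_INR; lia].
Qed.

Lemma sum_f_R0_split_first : forall f n,
  sum_f_R0 f (S n) = f O + sum_f_R0 (fun k => f (S k)) n.
Proof. intros f n; rewrite (decomp_sum f (S n)) by lia; reflexivity. Qed.

(** Both sides satisfy (n+1) V(n+1) = (a + b - n) V(n): in the convolution,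
    n+1 is split as k + (n+1-k). *)
Lemma gbinom_vandermonde : forall a b n,
  sum_f_R0 (fun k => gbinom a k * gbinom b (n - k)) n = gbinom (a + b) n.
Proof.
  intros a b n; induction n as [|n IH].
  - unfold gbinom; simpl; field.
  - assert (HS : INR (S n) <> 0) by (apply not_0_INR; lia).
    apply (Rmult_eq_reg_r (INR (S n))); [|exact HS].
    rewrite gbinom_S, <- IH.
    transitivity (sum_f_R0 (fun k => INR k * gbinom a k * gbinom b (S n - k)) (S n)
      + sum_f_R0 (fun k => gbinom a k * (INR (S n - k) * gbinom b (S n - k))) (S n)).
    { rewrite Rmult_comm, scal_sum, <- plus_sum; apply sum_eq; intros k Hk.
      rewrite (minus_INR (S n) k) by lia; ring. }
    rewrite (sum_f_R0_split_first (fun k => INR k * _ * _)).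
    rewrite (tech5 (fun k => gbinom a k * _)).
    rewrite Nat.sub_diag, Rmult_comm with (r2 := a + b - INR n), scal_sum.
    replace (INR 0) with 0 by reflexivity.
    match goal with |- 0 * ?a * ?b + ?X + (?Y + ?c * (0 * ?d)) = _ =>
      replace (0 * a * b + X + (Y + c * (0 * d))) with (X + Y) by ring end.
    rewrite <- plus_sum; apply sum_eq; intros k Hk.
    replace (S n - S k)%nat with (n - k)%nat by lia.
    replace (S n - k)%nat with (S (n - k)) by lia.
    rewrite (Rmult_comm (INR (S k))), gbinom_S.
    rewrite (Rmult_comm (INR (S (n - k)))), gbinom_S.
    rewrite minus_INR by lia; ring.
Qed.

Lemma falling_left : forall a k, falling a (S k) = a * falling (a - 1) k.
Proof.
  intros a k; induction k as [|k IH]; [simpl; ring|].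
  change (falling a (S (S k))) with (falling a (S k) * (a - INR (S k))).
  rewrite IH; cbn [falling]; rewrite S_INR; ring.
Qed.

Lemma gbinom_neg : forall M j,
  gbinom (- M) j = (- 1) ^ j * gbinom (M + INR j - 1) j.
Proof.
  intros M j; unfold gbinom.
  assert (H : falling (- M) j = (-1) ^ j * falling (M + INR j - 1) j).
  { induction j as [|j IH]; [simpl; ring|].
    rewrite (falling_left (M + INR (S j) - 1)).
    replace (M + INR (S j) - 1 - 1) with (M + INR j - 1) by (rewrite S_INR; ring).
    cbn [falling pow]; rewrite IH, S_INR; ring. }
  rewrite H; field; apply INR_fact_neq_0.
Qed.

Lemma falling_add : forall a k j,
  falling a (k + j) = falling a k * falling (a - INR k) j.
Proof.
  intros a k j; induction j as [|j IH]; [rewrite Nat.add_0_r; simpl; ring|].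
  rewrite Nat.add_succ_r; cbn [falling]; rewrite IH, plus_INR; ring.
Qed.

(** The identity C(a,k) C(a-k,l-k) = C(a,l) C(l,k), with C(l,k) an ordinary binomial
    coefficient so that the binomial theorem applies to the sum over k. *)
Lemma gbinom_trinomial : forall a k l, (k <= l)%nat ->
  gbinom a k * gbinom (a - INR k) (l - k) = gbinom a l * Binomial.C l k.
Proof.
  intros a k l Hkl; unfold gbinom, Binomial.C.
  replace (falling a l) with (falling a k * falling (a - INR k) (l - k))
    by (rewrite <- falling_add; f_equal; lia).
  field; repeat split; apply INR_fact_neq_0.
Qed.

Lemma sum_triangle : forall (g : nat -> nat -> R) n,
  sum_f_R0 (fun k => sum_f_R0 (g k) (n - k)) n
  = sum_f_R0 (fun l => sum_f_R0 (fun k => g k (l - k)%nat) l) n.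
Proof.
  intros g n; induction n as [|n IH]; [reflexivity|].
  rewrite (tech5 (fun l => sum_f_R0 _ l)), <- IH.
  rewrite (tech5 (fun k => sum_f_R0 (g k) _)), (tech5 (fun k => g k _)).
  rewrite Nat.sub_diag, <- Rplus_assoc, <- plus_sum; simpl (sum_f_R0 (g (S n)) 0).
  f_equal; apply sum_eq; intros k Hk.
  replace (S n - k)%nat with (S (n - k)) by lia; reflexivity.
Qed.

(** The coefficient form of the substitution w = v / (1 + p v) in the
    generating function: 1 - p w = 1/(1 + p v), 1 + q w = (1 + v)/(1 + p v) and
    dw / w^(n+1) = (1 + p v)^(n-1) dv / v^(n+1).  The algebraic proof
    writes the second binomial as C(N-k, n-k) with N-k = (x-k) + (N-x), expands
    it by Vandermonde, and resums q^l = (1 - p)^l by the binomial theorem. *)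
Lemma krawtchouk_negative_binomial : forall n x N p q, p + q = 1 ->
  krawtchouk n x N p q
  = sum_f_R0 (fun k => gbinom x k
        * (gbinom (- (INR N - INR n + 1)) (n - k) * p ^ (n - k))) n.
Proof.
  intros n x N p q Hpq; symmetry.
  transitivity (sum_f_R0 (fun k => sum_f_R0 (fun j =>
      gbinom x k * (- p) ^ (n - k) *
      (gbinom (x - INR k) j * gbinom (INR N - x) (n - k - j))) (n - k)) n).
  { apply sum_eq; intros k Hk.
    rewrite gbinom_neg.
    replace (INR N - INR n + 1 + INR (n - k) - 1) with ((x - INR k) + (INR N - x))
      by (rewrite minus_INR by lia; ring).
    rewrite <- gbinom_vandermonde.
    replace (- p) with (- 1 * p) by ring; rewrite Rpow_mult_distr.
    transitivity (gbinom x k * ((-1) ^ (n - k) * p ^ (n - k))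
      * sum_f_R0 (fun j => gbinom (x - INR k) j * gbinom (INR N - x) (n - k - j)) (n - k));
      [ring|].
    rewrite scal_sum; apply sum_eq; intros j _; ring. }
  rewrite sum_triangle; apply sum_eq; intros l Hl.
  replace (q ^ l) with ((1 + - p) ^ l) by (f_equal; lra).
  rewrite binomial.
  transitivity (gbinom x l * gbinom (INR N - x) (n - l) * (- p) ^ (n - l)
    * sum_f_R0 (fun i => Binomial.C l i * 1 ^ i * (- p) ^ (l - i)) l); [|ring].
  rewrite scal_sum; apply sum_eq; intros k Hk.
  replace (n - k - (l - k))%nat with (n - l)%nat by lia.
  replace (n - k)%nat with ((n - l) + (l - k))%nat by lia.
  rewrite pow_add, pow1.
  transitivity (gbinom x k * gbinom (x - INR k) (l - k)
    * ((- p) ^ (n - l) * (- p) ^ (l - k)) * gbinom (INR N - x) (n - l)); [ring|].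
  rewrite gbinom_trinomial by lia; ring.
Qed.

(** * The binomial series on a circle *)

(** The complex number 1 - t e^(i theta) has squared modulus [norm2] and argument
    minus [angle]. *)
Definition norm2 (theta t : R) : R := (1 - t * cos theta) ^ 2 + (t * sin theta) ^ 2.

Definition angle (theta t : R) : R := atan (t * sin theta / (1 - t * cos theta)).

Lemma one_minus_tcos_pos : forall theta t, 0 <= t < 1 -> 0 < 1 - t * cos theta.
Proof. intros theta t Ht; assert (H := COS_bound theta); nra. Qed.

Lemma norm2_pos : forall theta t, 0 <= t < 1 -> 0 < norm2 theta t.
Proof.
  intros theta t Ht; unfold norm2.
  assert (H := one_minus_tcos_pos theta t Ht).
  assert (0 < (1 - t * cos theta) ^ 2) by (apply pow_lt, H).
  assert (0 <= (t * sin theta) ^ 2) by apply pow2_ge_0; lra.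
Qed.

Lemma norm2_bounds : forall theta t r, 0 <= t <= r -> r < 1 ->
  (1 - r) ^ 2 <= norm2 theta t <= 4.
Proof.
  intros theta t r Ht Hr; unfold norm2.
  assert (E := sin2_cos2 theta); unfold Rsqr in E.
  assert (H := COS_bound theta).
  replace ((1 - t * cos theta) ^ 2 + (t * sin theta) ^ 2)
    with (1 - 2 * t * cos theta + t ^ 2 * (sin theta * sin theta + cos theta * cos theta)) by ring.
  rewrite E; nra.
Qed.

Lemma is_derive_log_norm : forall theta t, 0 <= t < 1 ->
  is_derive (fun t => ln (norm2 theta t) / 2) t ((t - cos theta) / norm2 theta t).
Proof.
  intros theta t Ht; assert (H := norm2_pos theta t Ht); unfold norm2 in *.
  auto_derive; [exact H|].
  assert (E := sin2_cos2 theta); unfold Rsqr in E.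
  transitivity ((t * (sin theta * sin theta + cos theta * cos theta) - cos theta)
    / ((1 - t * cos theta) ^ 2 + (t * sin theta) ^ 2)).
  - field; simpl in *; lra.
  - rewrite E, Rmult_1_r; reflexivity.
Qed.

Lemma is_derive_angle : forall theta t, 0 <= t < 1 ->
  is_derive (angle theta) t (sin theta / norm2 theta t).
Proof.
  intros theta t Ht; assert (H := norm2_pos theta t Ht).
  assert (H1 := one_minus_tcos_pos theta t Ht); unfold norm2, angle in *.
  auto_derive; [lra|]; unfold Rsqr.
  field; simpl in *; repeat split; try lra.
Qed.

Lemma is_derive_angle_theta : forall t theta, 0 <= t < 1 ->
  is_derive (fun theta => angle theta t) theta ((t * cos theta - t ^ 2) / norm2 theta t).
Proof.
  intros t theta Ht; assert (H := norm2_pos theta t Ht).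
  assert (H1 := one_minus_tcos_pos theta t Ht).
  assert (E := sin2_cos2 theta); unfold Rsqr in E.
  unfold norm2, angle in *.
  auto_derive; [lra|]; unfold Rsqr.
  transitivity ((t * cos theta - t ^ 2 * (sin theta * sin theta + cos theta * cos theta))
    / ((1 - t * cos theta) ^ 2 + (t * sin theta) ^ 2)).
  - field; simpl in *; repeat split; try lra.
  - rewrite E, Rmult_1_r; reflexivity.
Qed.

Lemma norm_at_0 : forall theta, norm2 theta 0 = 1 /\ angle theta 0 = 0.
Proof.
  intros theta; unfold norm2, angle; split; [ring|].
  replace (0 * sin theta / (1 - 0 * cos theta)) with 0 by field; apply atan_0.
Qed.

Definition log_bound (r : R) : R := ln 2 - ln (1 - r).

Lemma log_norm_bound : forall theta t r, 0 <= t <= r -> r < 1 ->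
  Rabs (ln (norm2 theta t) / 2) <= log_bound r.
Proof.
  intros theta t r Ht Hr; unfold log_bound.
  assert (H := norm2_bounds theta t r Ht Hr).
  assert (H0 : 0 < (1 - r) ^ 2) by (apply pow_lt; lra).
  assert (A : 2 * ln (1 - r) <= ln (norm2 theta t)).
  { replace (2 * ln (1 - r)) with (ln ((1 - r) ^ 2)).
    apply ln_le; lra. rewrite ln_pow by lra; simpl; ring. }
  assert (B : ln (norm2 theta t) <= 2 * ln 2).
  { replace (2 * ln 2) with (ln 4). apply ln_le; lra.
    replace 4 with (2 ^ 2) by ring; rewrite ln_pow by lra; simpl; ring. }
  assert (0 < ln 2) by (rewrite <- ln_1; apply ln_increasing; lra).
  assert (ln (1 - r) <= 0) by (rewrite <- ln_1; apply ln_le; lra).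
  apply Rabs_le; lra.
Qed.

Lemma exp_log_norm_bound : forall a theta t r, 0 <= t <= r -> r < 1 ->
  exp (a * (ln (norm2 theta t) / 2)) <= exp (Rabs a * log_bound r).
Proof.
  intros a theta t r Ht Hr.
  assert (H := log_norm_bound theta t r Ht Hr).
  apply exp_nondecreasing, Rle_trans with (1 := Rle_abs _); rewrite Rabs_mult.
  apply Rmult_le_compat_l; [apply Rabs_pos|exact H].
Qed.

(** Real and imaginary parts of the truncated series of (1 + v)^a at
    v = - t e^(i theta), and their derivatives in t. *)
Definition binom_re (a : R) (K : nat) (theta t : R) : R :=
  sum_f_R0 (fun k => gbinom a k * (- t) ^ k * cos (INR k * theta)) K.

Definition binom_im (a : R) (K : nat) (theta t : R) : R :=
  sum_f_R0 (fun k => gbinom a k * (- t) ^ k * sin (INR k * theta)) K.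

Definition binom_re' (a : R) (K : nat) (theta t : R) : R :=
  sum_f_R0 (fun k => gbinom a k * - (INR k * (- t) ^ pred k) * cos (INR k * theta)) K.

Definition binom_im' (a : R) (K : nat) (theta t : R) : R :=
  sum_f_R0 (fun k => gbinom a k * - (INR k * (- t) ^ pred k) * sin (INR k * theta)) K.

Lemma is_derive_sum_f_R0 : forall (f df : nat -> R -> R) t n,
  (forall k, is_derive (f k) t (df k t)) ->
  is_derive (fun t => sum_f_R0 (fun k => f k t) n) t (sum_f_R0 (fun k => df k t) n).
Proof.
  intros f df t n H; induction n as [|n IH]; [apply H|].
  apply (is_derive_plus (fun t => sum_f_R0 (fun k => f k t) n) (f (S n))); [exact IH|apply H].
Qed.

Lemma is_derive_binom_re : forall a K theta t,
  is_derive (binom_re a K theta) t (binom_re' a K theta t).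
Proof.
  intros; apply (is_derive_sum_f_R0
    (fun k t => gbinom a k * (- t) ^ k * cos (INR k * theta))
    (fun k t => gbinom a k * - (INR k * (- t) ^ pred k) * cos (INR k * theta))).
  intros k; auto_derive; [trivial|ring].
Qed.

Lemma is_derive_binom_im : forall a K theta t,
  is_derive (binom_im a K theta) t (binom_im' a K theta t).
Proof.
  intros; apply (is_derive_sum_f_R0
    (fun k t => gbinom a k * (- t) ^ k * sin (INR k * theta))
    (fun k t => gbinom a k * - (INR k * (- t) ^ pred k) * sin (INR k * theta))).
  intros k; auto_derive; [trivial|ring].
Qed.

Lemma binom_at_0 : forall a K theta, binom_re a K theta 0 = 1 /\ binom_im a K theta 0 = 0.
Proof.
  intros a K theta; induction K as [|K [H1 H2]].
  - unfold binom_re, binom_im, gbinom; simpl.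
    rewrite Rmult_0_l, cos_0, sin_0; split; field.
  - unfold binom_re, binom_im in *; rewrite 2!tech5, H1, H2.
    rewrite Ropp_0, pow_i by lia; split; ring.
Qed.

(** The truncation P of the binomial series satisfies
    (1 + v) P' = a P up to one monomial of degree K, whose coefficient this is. *)
Definition binom_defect (a : R) (K : nat) (t : R) : R :=
  INR (S K) * gbinom a (S K) * (- t) ^ K.

(** Real and imaginary parts of
    (1 - t e^(i theta)) dP/dt + a e^(i theta) P = [binom_defect] e^(i (K+1) theta). *)
Lemma binom_ode : forall a K theta t,
  (1 - t * cos theta) * binom_re' a K theta t + t * sin theta * binom_im' a K theta t
    + a * (cos theta * binom_re a K theta t - sin theta * binom_im a K theta t)
  = binom_defect a K t * cos (INR (S K) * theta) /\
  (1 - t * cos theta) * binom_im' a K theta t - t * sin theta * binom_re' a K theta t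
    + a * (cos theta * binom_im a K theta t + sin theta * binom_re a K theta t)
  = binom_defect a K t * sin (INR (S K) * theta).
Proof.
  intros a K theta t; unfold binom_defect.
  rewrite (Rmult_comm (INR (S K))), gbinom_S.
  induction K as [|K [IHr IHi]].
  - unfold binom_re, binom_im, binom_re', binom_im', gbinom; simpl.
    rewrite !Rmult_0_l, cos_0, sin_0, Rmult_1_l; split; field.
  - unfold binom_re, binom_im, binom_re', binom_im' in *.
    cbn [sum_f_R0 pred].
    assert (HC : cos (INR (S (S K)) * theta)
      = cos theta * cos (INR (S K) * theta) - sin theta * sin (INR (S K) * theta)).
    { rewrite <- cos_plus; f_equal; rewrite (S_INR (S K)); ring. }
    assert (HS : sin (INR (S (S K)) * theta)
      = sin theta * cos (INR (S K) * theta) + cos theta * sin (INR (S K) * theta)).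
    { rewrite <- sin_plus; f_equal; rewrite (S_INR (S K)); ring. }
    rewrite HC, HS.
    assert (HG := gbinom_S a K).
    rewrite <- HG in IHr, IHi.
    cbn [pow].
    set (C1 := cos (INR (S K) * theta)) in *; set (S1 := sin (INR (S K) * theta)) in *.
    split; [apply (Rplus_eq_reg_r (- (gbinom a (S K) * INR (S K) * (- t) ^ K * C1)));
            rewrite <- IHr at 1
           |apply (Rplus_eq_reg_r (- (gbinom a (S K) * INR (S K) * (- t) ^ K * S1)));
            rewrite <- IHi at 1]; ring.
Qed.

(** Derivatives of the real and imaginary parts of
    (P + i Q) exp(- a (l - i al)), the quotient of P + i Q by the polar form
    exp(a (l - i al)) of a power. *)
Lemma is_derive_twist : forall (P Q l al : R -> R) a t P' Q' l' al',
  is_derive P t P' -> is_derive Q t Q' -> is_derive l t l' -> is_derive al t al' ->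
  is_derive (fun t => exp (- a * l t) * (P t * cos (a * al t) - Q t * sin (a * al t))) t
    (exp (- a * l t) * (cos (a * al t) * (P' - a * (l' * P t + al' * Q t))
                      - sin (a * al t) * (Q' - a * (l' * Q t - al' * P t)))) /\
  is_derive (fun t => exp (- a * l t) * (P t * sin (a * al t) + Q t * cos (a * al t))) t
    (exp (- a * l t) * (sin (a * al t) * (P' - a * (l' * P t + al' * Q t))
                      + cos (a * al t) * (Q' - a * (l' * Q t - al' * P t)))).
Proof.
  intros P Q l al a t P' Q' l' al' HP HQ Hl Hal.
  assert (EP := is_derive_unique _ _ _ HP); assert (EQ := is_derive_unique _ _ _ HQ).
  assert (El := is_derive_unique _ _ _ Hl); assert (Ea := is_derive_unique _ _ _ Hal).
  split; (auto_derive; [repeat split; eexists; eassumption|]);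
    change (fun x : R => P x) with P; change (fun x : R => Q x) with Q;
    change (fun x : R => l x) with l; change (fun x : R => al x) with al;
    rewrite EP, EQ, El, Ea; ring.
Qed.

(** Multiplication by e^(i x), up to the factor 2 lost by working with
    coordinates. *)
Lemma rotation_bound : forall x A B b, Rabs A <= b -> Rabs B <= b ->
  Rabs (cos x * A - sin x * B) <= 2 * b /\ Rabs (sin x * A + cos x * B) <= 2 * b.
Proof.
  intros x A B b HA HB; assert (C := COS_bound x); assert (S := SIN_bound x).
  apply Rabs_le_between in HA; apply Rabs_le_between in HB.
  split; apply Rabs_le; split; nra.
Qed.

(** The quotient of the truncated series by (1 + v)^a equals 1 at t = 0,
    and by [binom_ode] its derivative along the ray is the defect times a
    bounded factor.  This gives an explicit error, uniform in theta, and
    identifies the limit of the truncated series with the polar form of the power. *)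
Lemma binom_series_error : forall a r, 0 <= r < 1 -> exists c, 0 <= c /\
  forall K theta,
  let l := ln (norm2 theta r) / 2 in
  let e := INR (S K) * Rabs (gbinom a (S K)) * r ^ K in
  Rabs (binom_re a K theta r - exp (a * l) * cos (a * angle theta r)) <= c * e /\
  Rabs (binom_im a K theta r + exp (a * l) * sin (a * angle theta r)) <= c * e.
Proof.
  intros a r Hr.
  set (X := exp (Rabs a * log_bound r)).
  assert (HX : 0 < X) by apply exp_pos.
  assert (Hd : 0 < / (1 - r) ^ 2) by (apply Rinv_0_lt_compat, pow_lt; lra).
  exists (12 * X * X * / (1 - r) ^ 2); split; [repeat apply Rmult_le_pos; lra|].
  intros K theta l e.
  assert (He : 0 <= e).
  { unfold e; repeat apply Rmult_le_pos; [apply pos_INR|apply Rabs_pos|apply pow_le; lra]. }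
  set (L := fun t => ln (norm2 theta t) / 2).
  set (P := binom_re a K theta); set (Q := binom_im a K theta).
  set (P' := binom_re' a K theta); set (Q' := binom_im' a K theta).
  set (L' := fun t => (t - cos theta) / norm2 theta t).
  set (A := angle theta). set (A' := fun t => sin theta / norm2 theta t).
  set (F := fun t => exp (- a * L t) * (P t * cos (a * A t) - Q t * sin (a * A t))).
  set (G := fun t => exp (- a * L t) * (P t * sin (a * A t) + Q t * cos (a * A t))).
  set (U := fun t => P' t - a * (L' t * P t + A' t * Q t)).
  set (V := fun t => Q' t - a * (L' t * Q t - A' t * P t)).
  assert (HD : forall t, 0 <= t <= r ->
    is_derive F t (exp (- a * L t) * (cos (a * A t) * U t - sin (a * A t) * V t)) /\
    is_derive G t (exp (- a * L t) * (sin (a * A t) * U t + cos (a * A t) * V t))).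
  { intros t Ht; apply (is_derive_twist P Q L A).
    apply is_derive_binom_re. apply is_derive_binom_im.
    apply is_derive_log_norm; lra. apply is_derive_angle; lra. }
  assert (HUV : forall t, 0 <= t <= r ->
    Rabs (U t) <= 3 * (e * / (1 - r) ^ 2) /\ Rabs (V t) <= 3 * (e * / (1 - r) ^ 2)).
  { intros t Ht.
    assert (Hn := norm2_bounds theta t r Ht (proj2 Hr)).
    assert (Hn0 := norm2_pos theta t ltac:(lra)).
    destruct (binom_ode a K theta t) as [O1 O2].
    fold P Q P' Q' in O1, O2.
    set (E := binom_defect a K t) in *.
    assert (HE : Rabs E <= e).
    { unfold E, e, binom_defect; rewrite !Rabs_mult, (Rabs_pos_eq (INR (S K))) by apply pos_INR.
      apply Rmult_le_compat_l; [apply Rmult_le_pos; [apply pos_INR|apply Rabs_pos]|].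
      rewrite <- RPow_abs, Rabs_Ropp; apply pow_incr; split; [apply Rabs_pos|].
      rewrite Rabs_pos_eq; lra. }
    set (C1 := cos (INR (S K) * theta)) in *; set (S1 := sin (INR (S K) * theta)) in *.
    assert (HC1 : -1 <= C1 <= 1) by apply COS_bound.
    assert (HS1 : -1 <= S1 <= 1) by apply SIN_bound.
    assert (Hct := one_minus_tcos_pos theta t ltac:(lra)).
    assert (Hc := COS_bound theta); assert (Hs := SIN_bound theta).
    assert (Hsc := sin2_cos2 theta); unfold Rsqr in Hsc.
    assert (EU : U t = ((1 - t * cos theta) * (E * C1) - t * sin theta * (E * S1)) * / norm2 theta t).
    { rewrite <- O1, <- O2; unfold U, L', A'.
      apply (Rmult_eq_reg_r (norm2 theta t)); [|lra].
      rewrite (Rmult_assoc _ (/ _)), Rinv_l by lra.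
      unfold Rdiv; transitivity (P' t * norm2 theta t
        - a * ((t - cos theta) * P t + sin theta * Q t)); [field; lra|].
      unfold norm2.
      transitivity (P' t * ((1 - t * cos theta) ^ 2 + (t * sin theta) ^ 2)
        - a * ((t * (sin theta * sin theta + cos theta * cos theta) - cos theta) * P t + sin theta * Q t));
        [rewrite Hsc; ring|ring]. }
    assert (EV : V t = ((1 - t * cos theta) * (E * S1) + t * sin theta * (E * C1)) * / norm2 theta t).
    { rewrite <- O1, <- O2; unfold V, L', A'.
      apply (Rmult_eq_reg_r (norm2 theta t)); [|lra].
      rewrite (Rmult_assoc _ (/ _)), Rinv_l by lra.
      unfold Rdiv; transitivity (Q' t * norm2 theta t
        - a * ((t - cos theta) * Q t - sin theta * P t)); [field; lra|].
      unfold norm2.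
      transitivity (Q' t * ((1 - t * cos theta) ^ 2 + (t * sin theta) ^ 2)
        - a * ((t * (sin theta * sin theta + cos theta * cos theta) - cos theta) * Q t - sin theta * P t));
        [rewrite Hsc; ring|ring]. }
    assert (Hi : / norm2 theta t <= / (1 - r) ^ 2)
      by (apply Rinv_le_contravar; [apply pow_lt; lra|lra]).
    assert (Hip : 0 < / norm2 theta t) by (apply Rinv_0_lt_compat; lra).
    assert (HEC : Rabs (E * C1) <= e).
    { rewrite Rabs_mult; assert (Rabs C1 <= 1) by (apply Rabs_le; lra).
      assert (X1 := Rabs_pos E); assert (X2 := Rabs_pos C1); nra. }
    assert (HES : Rabs (E * S1) <= e).
    { rewrite Rabs_mult; assert (Rabs S1 <= 1) by (apply Rabs_le; lra).
      assert (X1 := Rabs_pos E); assert (X2 := Rabs_pos S1); nra. }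
    apply Rabs_le_between in HEC; apply Rabs_le_between in HES.
    assert (Hct2 : 1 - t * cos theta <= 2) by nra.
    assert (Hst2 : -1 <= t * sin theta <= 1) by nra.
    rewrite EU, EV, !Rabs_mult, !(Rabs_pos_eq (/ norm2 theta t)), <- !Rmult_assoc by lra.
    split; (apply Rmult_le_compat; [apply Rabs_pos|lra| |exact Hi]);
      apply Rabs_le; split; nra. }
  assert (HB : forall t, 0 <= t <= r -> exp (- a * L t) <= X).
  { intros t Ht; unfold X; rewrite <- (Rabs_Ropp a); apply exp_log_norm_bound; lra. }
  assert (Hb2 : forall t w, 0 <= t <= r -> Rabs w <= 2 * (3 * (e * / (1 - r) ^ 2)) ->
    Rabs (exp (- a * L t) * w) <= X * (2 * (3 * (e * / (1 - r) ^ 2)))).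
  { intros t w Ht Hw; rewrite Rabs_mult, (Rabs_pos_eq (exp _)) by apply Rlt_le, exp_pos.
    apply Rmult_le_compat; [apply Rlt_le, exp_pos|apply Rabs_pos|apply HB, Ht|exact Hw]. }
  assert (HF := mean_value_bound F _ r (X * (2 * (3 * (e * / (1 - r) ^ 2)))) (proj1 Hr)
    (fun t Ht => proj1 (HD t Ht))
    (fun t Ht => Hb2 t _ Ht (proj1 (rotation_bound _ _ _ _ (proj1 (HUV t Ht)) (proj2 (HUV t Ht)))))).
  assert (HG := mean_value_bound G _ r (X * (2 * (3 * (e * / (1 - r) ^ 2)))) (proj1 Hr)
    (fun t Ht => proj2 (HD t Ht))
    (fun t Ht => Hb2 t _ Ht (proj2 (rotation_bound _ _ _ _ (proj1 (HUV t Ht)) (proj2 (HUV t Ht)))))).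
  assert (EF0 : F 0 = 1 /\ G 0 = 0).
  { unfold F, G, P, Q, L, A; destruct (binom_at_0 a K theta) as [-> ->].
    destruct (norm_at_0 theta) as [-> ->].
    rewrite ln_1, Rmult_0_r, cos_0, sin_0; unfold Rdiv; rewrite Rmult_0_l, Rmult_0_r, exp_0.
    split; ring. }
  destruct EF0 as [EF0 EG0]; rewrite EF0 in HF; rewrite EG0, Rminus_0_r in HG.
  assert (Hr1 : X * (2 * (3 * (e * / (1 - r) ^ 2))) * r <= 6 * X * e * / (1 - r) ^ 2).
  { assert (0 <= X * e * / (1 - r) ^ 2) by (apply Rmult_le_pos; [apply Rmult_le_pos|]; [apply Rlt_le, HX|exact He|lra]).
    clearbody e X; nra. }
  assert (Hexp : exp (a * l) * exp (- a * L r) = 1).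
  { unfold l, L; rewrite <- exp_plus, <- exp_0; f_equal; ring. }
  assert (Hal : 0 < exp (a * l) <= X).
  { split; [apply exp_pos|apply exp_log_norm_bound; lra]. }
  assert (HSC := sin2_cos2 (a * A r)); unfold Rsqr in HSC.
  assert (EP : P r - exp (a * l) * cos (a * A r)
     = exp (a * l) * (cos (a * A r) * (F r - 1) - - sin (a * A r) * G r)).
  { unfold F, G.
    transitivity (exp (a * l) * exp (- a * L r) * P r * (sin (a * A r) * sin (a * A r) + cos (a * A r) * cos (a * A r))
       - exp (a * l) * cos (a * A r)); [rewrite Hexp, HSC; ring|ring]. }
  assert (EQ : Q r + exp (a * l) * sin (a * A r)
     = exp (a * l) * (- sin (a * A r) * (F r - 1) + cos (a * A r) * G r)).
  { unfold F, G.
    transitivity (exp (a * l) * exp (- a * L r) * Q r * (sin (a * A r) * sin (a * A r) + cos (a * A r) * cos (a * A r))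
       + exp (a * l) * sin (a * A r)); [rewrite Hexp, HSC; ring|ring]. }
  rewrite EP, EQ, !Rabs_mult, !(Rabs_pos_eq (exp (a * l))) by lra.
  rewrite <- sin_neg, <- (cos_neg (a * A r)).
  destruct (rotation_bound (- (a * A r)) (F r - 1) (G r) (6 * X * e * / (1 - r) ^ 2)) as [R1 R2];
    [lra|lra|].
  replace (12 * X * X * / (1 - r) ^ 2 * e) with (X * (2 * (6 * X * e * / (1 - r) ^ 2))) by ring.
  split; (apply Rmult_le_compat; [lra|apply Rabs_pos|lra|assumption]).
Qed.

(** Ratio test: consecutive terms have ratio r |a - K - 1| / (K + 1), which
    is at most (1 + r)/2 < 1 for large K. *)
Lemma binom_coefficient_decay : forall a r, 0 <= r < 1 -> forall eps, 0 < eps ->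
  exists K0, forall K, (K0 <= K)%nat ->
  INR (S K) * Rabs (gbinom a (S K)) * r ^ K <= eps.
Proof.
  intros a r Hr eps Heps.
  set (e := fun K => INR (S K) * Rabs (gbinom a (S K)) * r ^ K).
  set (g := (1 + r) / 2).
  assert (He : forall K, 0 <= e K).
  { intros K; unfold e; apply Rmult_le_pos; [apply Rmult_le_pos|apply pow_le; lra];
    [apply pos_INR|apply Rabs_pos]. }
  destruct (nfloor_ex (2 * r * Rabs a / (1 - r))) as [K1 HK1].
  { apply Rmult_le_pos; [|apply Rlt_le, Rinv_0_lt_compat; lra].
    assert (X := Rabs_pos a); nra. }
  assert (Hstep : forall K, (K1 <= K)%nat -> e (S K) <= g * e K).
  { intros K HK; unfold e.
    assert (E : INR (S (S K)) * Rabs (gbinom a (S (S K)))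
       = Rabs (gbinom a (S K)) * Rabs (a - INR (S K))).
    { rewrite <- (Rabs_pos_eq (INR (S (S K)))) by apply pos_INR.
      rewrite <- !Rabs_mult, Rmult_comm, gbinom_S; reflexivity. }
    rewrite E; cbn [pow].
    assert (Hab : r * Rabs (a - INR (S K)) <= g * INR (S K)).
    { assert (T := Rabs_triang a (- INR (S K))).
      rewrite Rabs_Ropp, (Rabs_pos_eq (INR (S K))) in T by apply pos_INR.
      apply le_INR in HK.
      assert (B : 2 * r * Rabs a <= INR (S K) * (1 - r)).
      { destruct HK1 as [_ HK1]; rewrite S_INR.
        assert (2 * r * Rabs a = 2 * r * Rabs a / (1 - r) * (1 - r)) by (field; lra).
        nra. }
      unfold g, Rminus in *; nra. }
    assert (0 <= Rabs (gbinom a (S K)) * r ^ K)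
      by (apply Rmult_le_pos; [apply Rabs_pos|apply pow_le; lra]).
    replace (g * (INR (S K) * Rabs (gbinom a (S K)) * r ^ K))
      with (Rabs (gbinom a (S K)) * r ^ K * (g * INR (S K))) by ring.
    replace (Rabs (gbinom a (S K)) * Rabs (a - INR (S K)) * (r * r ^ K))
      with (Rabs (gbinom a (S K)) * r ^ K * (r * Rabs (a - INR (S K)))) by ring.
    apply Rmult_le_compat_l; assumption. }
  assert (Hgeo : forall j, e (K1 + j)%nat <= e K1 * g ^ j).
  { induction j as [|j IH]; [rewrite Nat.add_0_r; simpl; lra|].
    rewrite Nat.add_succ_r; eapply Rle_trans; [apply Hstep; lia|].
    cbn [pow]; unfold g in *; nra. }
  destruct (pow_lt_1_zero g) with (y := eps / (e K1 + 1)) as [J HJ].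
  { unfold g; rewrite Rabs_pos_eq; lra. }
  { specialize (He K1); apply Rdiv_lt_0_compat; lra. }
  exists (K1 + J)%nat; intros K HK.
  replace K with (K1 + (K - K1))%nat by lia.
  eapply Rle_trans; [apply Hgeo|].
  specialize (HJ (K - K1)%nat ltac:(lia)); specialize (He K1).
  rewrite Rabs_pos_eq in HJ by (apply pow_le; unfold g; lra).
  apply Rle_trans with ((e K1 + 1) * (eps / (e K1 + 1))).
  - apply Rmult_le_compat; try lra; apply pow_le; unfold g; lra.
  - right; field; lra.
Qed.

Lemma binom_series_uniform : forall a r, 0 <= r < 1 -> forall eps, 0 < eps ->
  exists K0, forall K, (K0 <= K)%nat -> forall theta,
  let l := ln (norm2 theta r) / 2 in
  Rabs (binom_re a K theta r - exp (a * l) * cos (a * angle theta r)) <= eps /\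
  Rabs (binom_im a K theta r + exp (a * l) * sin (a * angle theta r)) <= eps.
Proof.
  intros a r Hr eps Heps.
  destruct (binom_series_error a r Hr) as [c [Hc HB]].
  destruct (binom_coefficient_decay a r Hr (eps / (c + 1))) as [K0 HK0].
  { apply Rdiv_lt_0_compat; lra. }
  exists K0; intros K HK theta l.
  destruct (HB K theta) as [H1 H2]; specialize (HK0 K HK).
  set (e := INR (S K) * Rabs (gbinom a (S K)) * r ^ K) in *.
  assert (c * e <= eps).
  { apply Rle_trans with ((c + 1) * (eps / (c + 1))); [|right; field; lra].
    apply Rle_trans with (c * (eps / (c + 1))); [apply Rmult_le_compat_l; lra|].
    apply Rmult_le_compat_r; [apply Rlt_le, Rdiv_lt_0_compat|]; lra. }
  fold l in H1, H2; split; lra.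
Qed.

(** * The contour integral *)

Lemma sin_INR_PI : forall k, sin (INR k * PI) = 0.
Proof.
  intros k; apply sin_eq_0_1; exists (Z.of_nat k); rewrite INR_IZR_INZ; reflexivity.
Qed.

Lemma cos_INR_PI : forall n, cos (INR n * PI) = (- 1) ^ n.
Proof.
  induction n as [|n IH]; [simpl; rewrite Rmult_0_l; apply cos_0|].
  rewrite S_INR, Rmult_plus_distr_r, Rmult_1_l, neg_cos, IH; simpl; ring.
Qed.

Lemma cos_orthogonality : forall a b,
  is_RInt (fun t => cos ((INR a - INR b) * t)) 0 PI (if Nat.eqb a b then PI else 0).
Proof.
  intros a b; destruct (Nat.eqb_spec a b) as [<-|Hab].
  - apply (is_RInt_ext (fun _ => 1)).
    + intros t _; rewrite Rminus_diag, Rmult_0_l, cos_0; reflexivity.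
    + replace PI with (scal (PI - 0) 1 : R) at 2
        by (unfold scal; simpl; unfold mult; simpl; ring).
      apply (is_RInt_const (V := R_NormedModule)).
  - assert (Hd : INR a - INR b <> 0) by (apply Rminus_eq_contra, not_INR, Hab).
    evar_last.
    + apply (is_RInt_derive (fun t => sin ((INR a - INR b) * t) / (INR a - INR b))
        (fun t => cos ((INR a - INR b) * t))).
      * intros t _; auto_derive; [trivial|field; exact Hd].
      * intros t _; apply (ex_derive_continuous (fun t => cos ((INR a - INR b) * t))).
        auto_derive; trivial.
    + unfold minus, plus, opp; simpl; rewrite Rmult_0_r, sin_0.
      replace ((INR a - INR b) * PI) with (INR a * PI - INR b * PI) by ring.
      rewrite sin_minus, !sin_INR_PI; field; exact Hd.
Qed.

Lemma is_RInt_sum_f_R0 : forall (f : nat -> R -> R) (l : nat -> R) a b n,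
  (forall k, is_RInt (f k) a b (l k)) ->
  is_RInt (fun t => sum_f_R0 (fun k => f k t) n) a b (sum_f_R0 l n).
Proof.
  intros f l a b n H; induction n as [|n IH]; [apply H|].
  apply (is_RInt_plus (V := R_NormedModule) (fun t => sum_f_R0 (fun k => f k t) n) (f (S n)));
    [exact IH|apply H].
Qed.

Lemma sum_diagonal : forall (g : nat -> nat -> R) n K, (n <= K)%nat ->
  sum_f_R0 (fun k => sum_f_R0 (fun j => if Nat.eqb (k + j) n then g k j else 0) K) K
  = sum_f_R0 (fun k => g k (n - k)%nat) n.
Proof.
  intros g n K HK.
  assert (H1 : forall k m L, sum_f_R0 (fun j => if Nat.eqb j m then g k j else 0) L
     = if Nat.leb m L then g k m else 0).
  { intros k m L; induction L as [|L IH].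
    - simpl; destruct m; reflexivity.
    - rewrite tech5, IH.
      destruct (Nat.leb_spec m L); destruct (Nat.leb_spec m (S L));
      destruct (Nat.eqb_spec (S L) m); try lia; subst; ring. }
  transitivity (sum_f_R0 (fun k => if Nat.leb k n then g k (n - k)%nat else 0) K).
  - apply sum_eq; intros k Hk; destruct (Nat.leb_spec k n).
    + rewrite (sum_eq _ (fun j => if Nat.eqb j (n - k) then g k j else 0)).
      * rewrite H1; destruct (Nat.leb_spec (n - k) K); [reflexivity|lia].
      * intros j Hj; destruct (Nat.eqb_spec (k + j) n); destruct (Nat.eqb_spec j (n - k));
          try lia; reflexivity.
    + rewrite (sum_eq _ (fun _ => 0)); [rewrite sum_cte; ring|].
      intros j Hj; destruct (Nat.eqb_spec (k + j) n); [lia|reflexivity].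
  - induction K as [|K IH].
    + replace n with O by lia; reflexivity.
    + destruct (Nat.eq_dec n (S K)) as [->|Hn].
      * apply sum_eq; intros k Hk; destruct (Nat.leb_spec k (S K)); [reflexivity|lia].
      * rewrite tech5, IH by lia.
        destruct (Nat.leb_spec (S K) n); [lia|ring].
Qed.

(** Real part of (1 + v)^x (1 + p v)^(-M) e^(- i nu theta) at
    v = - r e^(i theta); the imaginary part is odd in theta, so [0, PI] suffices. *)
Definition contour_integrand (x M nu p r theta : R) : R :=
  exp (x * (ln (norm2 theta r) / 2) - M * (ln (norm2 theta (p * r)) / 2))
  * cos (- x * angle theta r + M * angle theta (p * r) - nu * theta).

Lemma contour_integrand_continuous : forall x M nu p r theta,
  0 < p < 1 -> 0 < r < 1 -> continuous (contour_integrand x M nu p r) theta.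
Proof.
  intros x M nu p r theta Hp Hr.
  apply (ex_derive_continuous (contour_integrand x M nu p r) theta).
  assert (Hpr : 0 <= p * r < 1) by nra.
  assert (H1 := norm2_pos theta r ltac:(lra)); assert (H2 := norm2_pos theta (p * r) Hpr).
  assert (A1 := is_derive_angle_theta r theta ltac:(lra)).
  assert (A2 := is_derive_angle_theta (p * r) theta Hpr).
  unfold contour_integrand, norm2 in *; auto_derive.
  repeat split; try assumption; eexists; eassumption.
Qed.

(** For K >= n, the product of the two series truncated at K is a trigonometric
    polynomial whose n-th coefficient is exactly that of
    [krawtchouk_negative_binomial]; the product tends to the integrand
    uniformly as K grows. *)
Lemma krawtchouk_contour_integral : forall n N x p q r,
  0 < p < 1 -> p + q = 1 -> 0 < r < 1 ->
  RInt (contour_integrand x (INR N - INR n + 1) (INR n) p r) 0 PI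
  = PI * ((- r) ^ n * krawtchouk n x N p q).
Proof.
  intros n N x p q r Hp Hpq Hr.
  set (M := INR N - INR n + 1).
  set (f := contour_integrand x M (INR n) p r).
  assert (Hpr : 0 <= p * r < 1) by nra.
  set (S := fun K t =>
    sum_f_R0 (fun k => sum_f_R0 (fun j =>
      (gbinom x k * (- r) ^ k * (gbinom (- M) j * (- (p * r)) ^ j))
      * cos ((INR (k + j) - INR n) * t)) K) K).
  assert (HS : forall K, (n <= K)%nat ->
    is_RInt (S K) 0 PI (PI * ((- r) ^ n * krawtchouk n x N p q))).
  { intros K HK; rewrite (krawtchouk_negative_binomial n x N p q Hpq).
    evar_last.
    - apply (is_RInt_sum_f_R0 (fun k t => sum_f_R0 (fun j =>
        (gbinom x k * (- r) ^ k * (gbinom (- M) j * (- (p * r)) ^ j))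
        * cos ((INR (k + j) - INR n) * t)) K)
       (fun k => sum_f_R0 (fun j => if Nat.eqb (k + j) n then
         gbinom x k * (- r) ^ k * (gbinom (- M) j * (- (p * r)) ^ j) * PI else 0) K)).
      intros k.
      apply (is_RInt_sum_f_R0 (fun j t =>
        (gbinom x k * (- r) ^ k * (gbinom (- M) j * (- (p * r)) ^ j))
        * cos ((INR (k + j) - INR n) * t))).
      intros j.
      replace (if Nat.eqb (k + j) n then _ else 0)
        with (gbinom x k * (- r) ^ k * (gbinom (- M) j * (- (p * r)) ^ j)
           * (if Nat.eqb (k + j) n then PI else 0))
        by (destruct (Nat.eqb (k + j) n); ring).
      apply (is_RInt_scal (V := R_NormedModule) (fun t => cos ((INR (k + j) - INR n) * t))).
      apply cos_orthogonality.
    - rewrite (sum_diagonal (fun k j => gbinom x k * (- r) ^ k * (gbinom (- M) j * (- (p * r)) ^ j) * PI))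
        by exact HK.
      rewrite scal_sum, scal_sum; apply sum_eq; intros k Hk.
      replace ((- r) ^ n) with ((- r) ^ k * (- r) ^ (n - k)) by (rewrite <- pow_add; f_equal; lia).
      replace (- (p * r)) with (p * - r) by ring; rewrite Rpow_mult_distr; unfold M; ring. }
  assert (Hprod : forall K t, S K t
     = (binom_re x K t r * binom_re (- M) K t (p * r)
        - binom_im x K t r * binom_im (- M) K t (p * r)) * cos (INR n * t)
     + (binom_re x K t r * binom_im (- M) K t (p * r)
        + binom_im x K t r * binom_re (- M) K t (p * r)) * sin (INR n * t)).
  { intros K t.
    set (c := fun k => gbinom x k * (- r) ^ k).
    set (d := fun j => gbinom (- M) j * (- (p * r)) ^ j).
    assert (Hd : forall (u v : nat -> R),
      sum_f_R0 (fun k => sum_f_R0 (fun j => u k * v j) K) K = sum_f_R0 u K * sum_f_R0 v K).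
    { intros u v; rewrite Rmult_comm, scal_sum; apply sum_eq; intros k _.
      rewrite scal_sum; apply sum_eq; intros; ring. }
    unfold binom_re, binom_im.
    fold c d.
    rewrite <- !Hd.
    rewrite <- !minus_sum, <- !plus_sum.
    rewrite (Rmult_comm _ (cos (INR n * t))), (Rmult_comm _ (sin (INR n * t))), !scal_sum.
    rewrite <- plus_sum; apply sum_eq; intros k _.
    rewrite <- !minus_sum, <- !plus_sum.
    rewrite (Rmult_comm _ (cos (INR n * t))), (Rmult_comm _ (sin (INR n * t))), !scal_sum.
    rewrite <- plus_sum; apply sum_eq; intros j _.
    replace ((INR (k + j) - INR n) * t) with ((INR k * t + INR j * t) - INR n * t)
      by (rewrite plus_INR; ring).
    rewrite cos_minus, cos_plus, sin_plus; unfold c, d; ring. }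
  set (X := exp (Rabs x * log_bound r)); set (Y := exp (Rabs (- M) * log_bound (p * r))).
  assert (HX : 0 < X) by apply exp_pos; assert (HY : 0 < Y) by apply exp_pos.
  assert (Happrox : forall eps, 0 < eps -> eps <= 1 ->
    exists K, (n <= K)%nat /\ forall t, Rabs (f t - S K t) <= 4 * (X + Y + 1) * eps).
  { intros eps He He1.
    destruct (binom_series_uniform x r ltac:(lra) eps He) as [K1 H1].
    destruct (binom_series_uniform (- M) (p * r) Hpr eps He) as [K2 H2].
    set (K := (n + K1 + K2)%nat); exists K; split; [unfold K; lia|].
    intros t; specialize (H1 K ltac:(unfold K; lia) t); specialize (H2 K ltac:(unfold K; lia) t).
    cbv zeta in H1, H2; destruct H1 as [P1 P2], H2 as [Q1 Q2].
    rewrite Hprod; unfold f, contour_integrand.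
    set (l1 := ln (norm2 t r) / 2) in *; set (l2 := ln (norm2 t (p * r)) / 2) in *.
    set (a1 := angle t r) in *; set (a2 := angle t (p * r)) in *.
    set (u1 := binom_re x K t r) in *; set (u2 := binom_im x K t r) in *.
    set (v1 := binom_re (- M) K t (p * r)) in *; set (v2 := binom_im (- M) K t (p * r)) in *.
    replace (- x * a1 + M * a2 - INR n * t) with (- (x * a1) + - (- M * a2) - INR n * t) by ring.
    replace (x * l1 - M * l2) with (x * l1 + - M * l2) by ring.
    rewrite exp_plus, cos_minus, cos_plus, sin_plus, !cos_neg, !sin_neg.
    assert (E1 : 0 < exp (x * l1) <= X) by (split; [apply exp_pos|apply exp_log_norm_bound; lra]).
    assert (E2 : 0 < exp (- M * l2) <= Y) by (split; [apply exp_pos|apply exp_log_norm_bound; lra]).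
    set (e1 := exp (x * l1)) in *; set (e2 := exp (- M * l2)) in *.
    assert (B : forall e c, -1 <= c <= 1 -> 0 < e -> Rabs (e * c) <= e).
    { intros e c Hc He0; rewrite Rabs_mult, (Rabs_pos_eq e) by lra.
      assert (Rabs c <= 1) by (apply Rabs_le; lra); nra. }
    assert (W1 := B e1 _ (COS_bound (x * a1)) (proj1 E1)).
    assert (W2 := B e1 _ (SIN_bound (x * a1)) (proj1 E1)).
    assert (V1 := B e2 _ (COS_bound (- M * a2)) (proj1 E2)).
    assert (V2 := B e2 _ (SIN_bound (- M * a2)) (proj1 E2)).
    set (w1 := e1 * cos (x * a1)) in *; set (w2 := e1 * sin (x * a1)) in *.
    set (y1 := e2 * cos (- M * a2)) in *; set (y2 := e2 * sin (- M * a2)) in *.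
    assert (HP : forall u w v y, Rabs (u - w) <= eps -> Rabs (v - y) <= eps ->
      Rabs w <= e1 -> Rabs y <= e2 -> Rabs (w * y - u * v) <= (X + Y + 1) * eps).
    { intros u w v y A1 A2 A3 A4.
      replace (w * y - u * v) with (- (w * (v - y)) - (u - w) * y - (u - w) * (v - y)) by ring.
      eapply Rle_trans; [apply Rabs_triang|].
      eapply Rle_trans; [apply Rplus_le_compat_r, Rabs_triang|].
      rewrite !Rabs_Ropp, !Rabs_mult.
      assert (Z1 := Rabs_pos (u - w)); assert (Z2 := Rabs_pos (v - y)).
      assert (Z3 := Rabs_pos w); assert (Z4 := Rabs_pos y); nra. }
    replace (u2 + w2) with (u2 - - w2) in P2 by ring.
    replace (v2 + y2) with (v2 - - y2) in Q2 by ring.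
    rewrite <- (Rabs_Ropp w2) in W2; rewrite <- (Rabs_Ropp y2) in V2.
    assert (D11 := HP _ _ _ _ P1 Q1 W1 V1). assert (D22 := HP _ _ _ _ P2 Q2 W2 V2).
    assert (D12 := HP _ _ _ _ P1 Q2 W1 V2). assert (D21 := HP _ _ _ _ P2 Q1 W2 V1).
    match goal with |- Rabs ?g <= _ => replace g with
      ((w1 * y1 - u1 * v1) * cos (INR n * t) - (- w2 * - y2 - u2 * v2) * cos (INR n * t)
       + (w1 * - y2 - u1 * v2) * sin (INR n * t) + (- w2 * y1 - u2 * v1) * sin (INR n * t))
      by (unfold w1, w2, y1, y2; ring) end.
    assert (B2 : forall z c, Rabs z <= (X + Y + 1) * eps -> -1 <= c <= 1 ->
       Rabs (z * c) <= (X + Y + 1) * eps).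
    { intros z c Hz Hc; rewrite Rabs_mult.
      assert (Rabs c <= 1) by (apply Rabs_le; lra).
      assert (Z := Rabs_pos z); assert (Z' := Rabs_pos c); nra. }
    assert (F1 := B2 _ _ D11 (COS_bound (INR n * t))).
    assert (F2 := B2 _ _ D22 (COS_bound (INR n * t))).
    assert (F3 := B2 _ _ D12 (SIN_bound (INR n * t))).
    assert (F4 := B2 _ _ D21 (SIN_bound (INR n * t))).
    apply Rabs_le_between in F1; apply Rabs_le_between in F2.
    apply Rabs_le_between in F3; apply Rabs_le_between in F4.
    apply Rabs_le; lra. }
  assert (Hf : forall t, continuous f t)
    by (intros t; apply contour_integrand_continuous; assumption).
  apply Rminus_diag_uniq; apply Rabs_eq_0.
  apply Rle_antisym; [|apply Rabs_pos].
  apply le_epsilon; intros e He.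
  assert (HPI := PI_RGT_0).
  set (D := PI * (4 * (X + Y + 1))).
  assert (HD : 0 < D) by (unfold D; nra).
  destruct (Happrox (Rmin 1 (e / D))) as [K [HK HA]].
  { apply Rmin_glb_lt; [lra|apply Rdiv_lt_0_compat; lra]. }
  { apply Rmin_l. }
  specialize (HS K HK).
  assert (Hex : ex_RInt f 0 PI) by (apply ex_RInt_of_continuous, Hf).
  rewrite <- (is_RInt_unique _ _ _ _ HS).
  assert (Em : RInt (fun t => f t - S K t) 0 PI = RInt f 0 PI - RInt (S K) 0 PI).
  { apply (RInt_minus (V := R_CompleteNormedModule) f (S K)); [exact Hex|eexists; exact HS]. }
  rewrite <- Em.
  eapply Rle_trans.
  - apply (abs_RInt_le_const (fun t => f t - S K t) 0 PI (4 * (X + Y + 1) * Rmin 1 (e / D))).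
    + lra.
    + apply (ex_RInt_minus (V := R_NormedModule) f (S K)); [exact Hex|eexists; exact HS].
    + intros t _; apply HA.
  - apply Rle_trans with (D * (e / D)); [|right; field; lra].
    replace ((PI - 0) * (4 * (X + Y + 1) * Rmin 1 (e / D))) with (D * Rmin 1 (e / D))
      by (unfold D; ring).
    apply Rmult_le_compat_l; [lra|apply Rmin_r].
Qed.

(** * Asymptotics of an integral with a cubic phase *)

(** An integral of exp(g) cos(phi), where g = O(lam^3 s^2 + lam s) and phi' = F are
    functions of s = 1 - cos t, phi being a cubic in lam t to leading order.
    The bounds on G = g' make exp(g) close to 1 for t = O(1/lam), decreasing from
    some T/lam on, and exponentially small at fixed t; the bounds on F' and F(0)
    make F positive and increasing between T/lam and a fixed angle.  All
    constants enter through c, C and s0 only, hence the uniformity. *)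
Lemma airy_asymptotics : forall c C s0 eta,
  0 < c <= 1 -> 1 <= C -> 0 < s0 -> 0 < eta ->
  exists Lam, 1 <= Lam /\ forall lam k b (g G phi F F' : R -> R),
  Lam <= lam -> 0 < k -> c <= k ^ 3 <= C -> Rabs b <= C ->
  g 0 = 0 -> phi 0 = 0 ->
  (forall s, 0 <= s <= 2 -> is_derive g s (G s)) ->
  (forall t, is_derive phi t (F (1 - cos t))) ->
  (forall s, 0 <= s <= 2 -> is_derive F s (F' s)) ->
  (forall t, continuous (fun t => exp (g (1 - cos t)) * cos (phi t)) t) ->
  (forall s, 0 <= s <= 2 -> G s <= - c * lam ^ 3 * s + C * lam) ->
  (forall s, 0 <= s <= 2 -> Rabs (G s) <= C * (lam ^ 3 * s + lam)) ->
  (forall s, 0 <= s <= s0 -> s <= 2 -> c * lam ^ 3 <= F' s) ->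
  - C * lam <= F 0 ->
  (forall s, 0 <= s <= 2 ->
     Rabs (F s - (2 * k ^ 3 * lam ^ 3 * s + b * lam)) <= C * (lam ^ 3 * s ^ 2 + lam * s + 1)) ->
  Rabs (lam * RInt (fun t => exp (g (1 - cos t)) * cos (phi t)) 0 PI
        - / k * (PI * Airy (b / k))) <= eta.
Proof.
  intros c C s0 eta Hc HC Hs0 Heta.
  (* X bounds b/k.  T makes the tail of Airy's integral small (HT1) and the
     terms in lam^3 dominate those in lam at t = T/lam (HT2); th0 keeps s below
     s0; del lam^3 bounds the decay of g beyond th0. *)
  set (X := C / c).
  set (T := 1 + (X + 8 / (c * eta)) / c ^ 2 + 4 * (C + 16 / eta) / c).
  set (th0 := Rmin 1 s0).
  set (del := c * (th0 ^ 2 / 4) ^ 2 / 2).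
  assert (Hth0 : 0 < th0 <= 1).
  { split; [apply Rmin_glb_lt; lra|apply Rmin_l]. }
  assert (Hth0s : th0 ^ 2 <= s0).
  { assert (th0 <= s0) by apply Rmin_r; nra. }
  assert (Hdel : 0 < del) by (unfold del; assert (0 < (th0 ^ 2 / 4) ^ 2) by (apply pow_lt, Rdiv_lt_0_compat; [apply pow_lt|]; lra); nra).
  assert (HX : 0 < X) by (apply Rdiv_lt_0_compat; lra).
  assert (H8 : 0 < 8 / (c * eta)) by (apply Rdiv_lt_0_compat; nra).
  assert (H16 : 0 < 16 / eta) by (apply Rdiv_lt_0_compat; lra).
  assert (Ha : 0 < (X + 8 / (c * eta)) / c ^ 2) by (apply Rdiv_lt_0_compat; nra).
  assert (Hb : 0 < 4 * (C + 16 / eta) / c) by (apply Rdiv_lt_0_compat; nra).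
  assert (HT : 1 <= T) by (unfold T; lra).
  assert (HTT : T <= T ^ 2) by nra.
  assert (HT1 : X + 8 / (c * eta) <= c ^ 2 * T ^ 2).
  { apply Rle_trans with (c ^ 2 * ((X + 8 / (c * eta)) / c ^ 2)); [right; field; lra|].
    apply Rmult_le_compat_l; [nra|unfold T in *; lra]. }
  assert (HT2 : C + 16 / eta <= c * T ^ 2 / 4).
  { apply Rle_trans with (c * (4 * (C + 16 / eta) / c) / 4); [right; field; lra|].
    unfold Rdiv at 1 4; apply Rmult_le_compat_r; [lra|].
    apply Rmult_le_compat_l; [lra|unfold T in *; lra]. }
  clearbody T.
  set (Lam := T / th0 + 32 * C * T ^ 6 / eta + 4 * C * T ^ 4 + (2 * C + 16 / eta) / del + 1).
  assert (L1 : 0 < T / th0) by (apply Rdiv_lt_0_compat; lra).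
  assert (L2 : 0 < 32 * C * T ^ 6 / eta).
  { apply Rdiv_lt_0_compat; [|lra]; apply Rmult_lt_0_compat; [lra|apply pow_lt; lra]. }
  assert (L3 : 0 < 4 * C * T ^ 4) by (apply Rmult_lt_0_compat; [lra|apply pow_lt; lra]).
  assert (L4 : 0 < (2 * C + 16 / eta) / del) by (apply Rdiv_lt_0_compat; lra).
  exists Lam; split; [unfold Lam; lra|].
  intros lam k b g G phi F F' Hlam Hk Hk3 Hb1 Hg0 Hphi0 Hg Hphi HF Hcont HG1 HG2 HF1 HF0 HF2.
  set (f := fun t => exp (g (1 - cos t)) * cos (phi t)) in *.
  assert (Hlam1 : 1 <= lam) by (unfold Lam in *; lra).
  assert (HP := PI_RGT_0); assert (HP4 := PI_4).
  assert (HP1 := PI2_1).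
  assert (Htau : T / lam <= th0).
  { assert (T / th0 <= lam) by (unfold Lam in *; lra).
    apply Rmult_le_reg_r with (lam / th0); [apply Rdiv_lt_0_compat; lra|].
    replace (T / lam * (lam / th0)) with (T / th0) by (field; lra).
    replace (th0 * (lam / th0)) with lam by (field; lra); assumption. }
  set (tau := T / lam) in *.
  assert (Htaulam : tau * lam = T) by (unfold tau; field; lra).
  assert (Htau0 : 0 < tau) by (apply Rdiv_lt_0_compat; lra).
  assert (Hkc : c <= k).
  { destruct (Rle_lt_dec c k) as [H|H]; [exact H|].
    exfalso; clear - Hc Hk Hk3 H; assert (k ^ 2 < 1) by nra; nra. }
  assert (Hbk : Rabs (b / k) <= X).
  { unfold Rdiv; rewrite Rabs_mult, (Rabs_pos_eq (/ k)) by (apply Rlt_le, Rinv_0_lt_compat, Hk).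
    apply Rmult_le_compat; [apply Rabs_pos|apply Rlt_le, Rinv_0_lt_compat, Hk|exact Hb1|].
    apply Rinv_le_contravar; lra. }
  assert (Hs : forall t, 0 <= 1 - cos t <= 2) by (intros t; assert (Y := COS_bound t); lra).
  assert (Hl3 : 0 < lam ^ 3) by (apply pow_lt; lra).
  assert (P1 : Rabs (lam * RInt (fun t => cos (k ^ 3 * lam ^ 3 * t ^ 3 / 3 + b * lam * t)) 0 tau
                     - / k * (PI * Airy (b / k))) <= eta / 4).
  { unfold tau; rewrite airy_rescaling by lra.
    rewrite <- Rmult_minus_distr_l, Rabs_mult, (Rabs_pos_eq (/ k))
      by (apply Rlt_le, Rinv_0_lt_compat, Hk).
    assert (HkT : c ^ 2 * T ^ 2 <= (k * T) ^ 2).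
    { replace ((k * T) ^ 2) with (k ^ 2 * T ^ 2) by ring.
      apply Rmult_le_compat_r; [apply pow2_ge_0|apply pow_incr; lra]. }
    assert (A := airy_truncation (b / k) X (k * T) ltac:(apply Rmult_lt_0_compat; lra) Hbk ltac:(lra)).
    apply Rle_trans with (/ c * (2 / (8 / (c * eta)))); [|right; field; lra].
    apply Rmult_le_compat; [apply Rlt_le, Rinv_0_lt_compat, Hk|apply Rabs_pos| |].
    - apply Rinv_le_contravar; lra.
    - eapply Rle_trans; [exact A|]; unfold Rdiv at 1 2; apply Rmult_le_compat_l; [lra|].
      apply Rinv_le_contravar; lra. }
  (* For t <= tau = T/lam, s is at most T^2/lam^2, so that every error term of
     g and phi is O(1/lam). *)
  assert (Hgs : forall t, 0 <= t <= tau -> Rabs (g (1 - cos t)) <= 2 * C * T ^ 4 / lam).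
  { intros t Ht.
    assert (U := one_minus_cos_upper t ltac:(lra)); set (s := 1 - cos t) in *.
    assert (S := Hs t); fold s in S.
    assert (M : Rabs (g s - g 0) <= C * (lam ^ 3 * s + lam) * s).
    { apply (mean_value_bound g G); [lra| |].
      - intros; apply Hg; lra.
      - intros u Hu; eapply Rle_trans; [apply HG2; lra|].
        apply Rmult_le_compat_l; [lra|]; apply Rplus_le_compat_r.
        apply Rmult_le_compat_l; lra. }
    rewrite Hg0, Rminus_0_r in M; eapply Rle_trans; [exact M|].
    assert (Hss : s * lam ^ 2 <= T ^ 2).
    { assert (t ^ 2 <= tau ^ 2) by (apply pow_incr; lra).
      rewrite <- Htaulam, Rpow_mult_distr; apply Rmult_le_compat_r; [apply pow2_ge_0|lra]. }
    apply Rmult_le_reg_r with lam; [lra|].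
    replace (2 * C * T ^ 4 / lam * lam) with (C * (T ^ 2 * T ^ 2 + T ^ 2 * T ^ 2)) by (field; lra).
    replace (C * (lam ^ 3 * s + lam) * s * lam)
      with (C * ((s * lam ^ 2) * (s * lam ^ 2) + s * lam ^ 2)) by ring.
    apply Rmult_le_compat_l; [lra|].
    assert (0 <= s * lam ^ 2) by (apply Rmult_le_pos; [lra|apply pow2_ge_0]).
    assert (1 <= T ^ 2) by lra.
    apply Rplus_le_compat; [apply Rmult_le_compat; lra|].
    apply Rle_trans with (T ^ 2 * 1); [lra|apply Rmult_le_compat_l; lra]. }
  assert (Hgh : 2 * C * T ^ 4 / lam <= / 2).
  { assert (4 * C * T ^ 4 <= lam) by (unfold Lam in *; lra).
    apply Rmult_le_reg_r with lam; [lra|].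
    replace (2 * C * T ^ 4 / lam * lam) with (2 * C * T ^ 4) by (field; lra); lra. }
  assert (Hphs : forall t, 0 <= t <= tau ->
    Rabs (phi t - (k ^ 3 * lam ^ 3 * t ^ 3 / 3 + b * lam * t)) <= 4 * C * T ^ 5 / lam).
  { intros t Ht.
    set (h := fun u => phi u - (k ^ 3 * lam ^ 3 * u ^ 3 / 3 + b * lam * u)).
    assert (M : Rabs (h t - h 0) <= 4 * C * T ^ 4 * t).
    { apply (mean_value_bound h (fun u => F (1 - cos u) - (k ^ 3 * lam ^ 3 * u ^ 2 + b * lam))); [lra| |].
      - intros u Hu; apply (is_derive_minus phi); [apply Hphi|].
        auto_derive; [trivial|field].
      - intros u Hu.
        assert (U := one_minus_cos_upper u ltac:(lra)).
        assert (L := one_minus_cos_lower u ltac:(lra)).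
        assert (B := HF2 _ (Hs u)); assert (S := Hs u).
        set (s := 1 - cos u) in *.
        assert (Hul : 0 <= u * lam <= T).
        { split; [apply Rmult_le_pos; lra|]; rewrite <- Htaulam; apply Rmult_le_compat_r; lra. }
        assert (Hu2 : (u * lam) ^ 2 <= T ^ 2) by (apply pow_incr; exact Hul).
        assert (Hu4 : (u * lam) ^ 4 <= T ^ 4) by (apply pow_incr; exact Hul).
        assert (HT4 : T ^ 2 <= T ^ 4) by (apply Rle_pow; [lra|lia]).
        assert (U4 : 0 <= u ^ 4) by (apply pow_le; lra).
        assert (Hlu4 : lam ^ 3 * u ^ 4 <= T ^ 4).
        { replace ((u * lam) ^ 4) with (lam * (lam ^ 3 * u ^ 4)) in Hu4 by ring.
          apply Rle_trans with (2 := Hu4), le_scale_up; [lra|apply Rmult_le_pos; lra]. }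
        assert (Hlu2 : lam * u ^ 2 <= T ^ 2).
        { replace ((u * lam) ^ 2) with (lam * (lam * u ^ 2)) in Hu2 by ring.
          apply Rle_trans with (2 := Hu2), le_scale_up;
            [lra|apply Rmult_le_pos; [lra|apply pow2_ge_0]]. }
        assert (R1 : lam ^ 3 * s ^ 2 + lam * s + 1 <= 3 * T ^ 4).
        { assert (s ^ 2 <= u ^ 4).
          { replace (u ^ 4) with ((u ^ 2) ^ 2) by ring; apply pow_incr.
            assert (0 <= u ^ 2) by apply pow2_ge_0; lra. }
          assert (lam ^ 3 * s ^ 2 <= lam ^ 3 * u ^ 4) by (apply Rmult_le_compat_l; lra).
          assert (lam * s <= lam * u ^ 2) by (apply Rmult_le_compat_l; [lra|assert (0 <= u ^ 2) by apply pow2_ge_0; lra]).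
          lra. }
        assert (R2 : Rabs (2 * k ^ 3 * lam ^ 3 * (s - u ^ 2 / 2)) <= C * T ^ 4).
        { rewrite Rabs_mult, (Rabs_pos_eq (2 * k ^ 3 * lam ^ 3))
            by (apply Rmult_le_pos; lra).
          apply Rle_trans with (2 * k ^ 3 * lam ^ 3 * (u ^ 4 / 24)).
          - apply Rmult_le_compat_l; [apply Rmult_le_pos; lra|].
            apply Rabs_le; lra.
          - replace (2 * k ^ 3 * lam ^ 3 * (u ^ 4 / 24))
              with (k ^ 3 * (lam ^ 3 * u ^ 4 / 12)) by field.
            assert (0 <= lam ^ 3 * u ^ 4) by (apply Rmult_le_pos; lra).
            apply Rmult_le_compat; lra. }
        replace (F s - (k ^ 3 * lam ^ 3 * u ^ 2 + b * lam))
          with ((F s - (2 * k ^ 3 * lam ^ 3 * s + b * lam))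
             + 2 * k ^ 3 * lam ^ 3 * (s - u ^ 2 / 2)) by field.
        eapply Rle_trans; [apply Rabs_triang|].
        assert (C * (lam ^ 3 * s ^ 2 + lam * s + 1) <= C * (3 * T ^ 4))
          by (apply Rmult_le_compat_l; lra).
        lra. }
    unfold h in M; rewrite Hphi0 in M.
    replace (0 - (k ^ 3 * lam ^ 3 * 0 ^ 3 / 3 + b * lam * 0)) with 0 in M by field.
    rewrite Rminus_0_r in M; eapply Rle_trans; [exact M|].
    replace (4 * C * T ^ 5 / lam) with (4 * C * T ^ 4 * tau) by (unfold tau; field; lra).
    apply Rmult_le_compat_l; lra. }
  assert (P2 : Rabs (RInt f 0 tau
       - RInt (fun t => cos (k ^ 3 * lam ^ 3 * t ^ 3 / 3 + b * lam * t)) 0 tau)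
     <= (tau - 0) * (8 * C * T ^ 5 / lam)).
  { apply RInt_dist_le; [lra|exact Hcont| |].
    - intros t; apply (ex_derive_continuous (fun t => cos (k ^ 3 * lam ^ 3 * t ^ 3 / 3 + b * lam * t))).
      auto_derive; trivial.
    - intros t Ht; unfold f.
      assert (A1 := Hgs t Ht); assert (A2 := Hphs t Ht).
      assert (A3 := exp_minus_one_bound _ (Rle_trans _ _ _ A1 Hgh)).
      set (E := exp (g (1 - cos t))) in *.
      set (ps := k ^ 3 * lam ^ 3 * t ^ 3 / 3 + b * lam * t) in *.
      replace (E * cos (phi t) - cos ps) with ((E - 1) * cos (phi t) + (cos (phi t) - cos ps)) by ring.
      eapply Rle_trans; [apply Rabs_triang|].
      assert (A4 := cos_lipschitz (phi t) ps).
      rewrite Rabs_mult.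
      assert (A5 : Rabs (cos (phi t)) <= 1) by (apply Rabs_le, COS_bound).
      assert (A6 : 2 * C * T ^ 4 / lam <= 2 * C * T ^ 5 / lam).
      { unfold Rdiv; apply Rmult_le_compat_r; [apply Rlt_le, Rinv_0_lt_compat; lra|].
        apply Rmult_le_compat_l; [lra|]; apply Rle_pow; [lra|lia]. }
      assert (A7 := Rabs_pos (E - 1)); assert (A8 := Rabs_pos (cos (phi t))).
      replace (8 * C * T ^ 5 / lam)
        with (2 * (2 * C * T ^ 5 / lam) + 4 * C * T ^ 5 / lam) by (field; lra).
      apply Rplus_le_compat; [|lra].
      apply Rle_trans with (Rabs (E - 1) * 1); [apply Rmult_le_compat_l; lra|lra]. }
  assert (P2' : lam * ((tau - 0) * (8 * C * T ^ 5 / lam)) <= eta / 4).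
  { replace (lam * ((tau - 0) * (8 * C * T ^ 5 / lam))) with (8 * C * T ^ 6 / lam)
      by (unfold tau; field; lra).
    assert (L : 32 * C * T ^ 6 / eta <= lam) by (unfold Lam in *; lra).
    apply Rmult_le_reg_r with (4 * lam / eta); [apply Rdiv_lt_0_compat; lra|].
    replace (8 * C * T ^ 6 / lam * (4 * lam / eta)) with (32 * C * T ^ 6 / eta) by (field; lra).
    replace (eta / 4 * (4 * lam / eta)) with lam by (field; lra); exact L. }
  (* From tau on, s lam^2 >= T^2/4, which makes the leading terms of G and F
     dominate; the weight exp(g)/F then decreases. *)
  assert (Hsl : forall t, tau <= t <= th0 -> T ^ 2 / 4 <= (1 - cos t) * lam ^ 2).
  { intros t Ht.
    assert (t ^ 2 / 4 <= 1 - cos t) by (apply one_minus_cos_quarter; lra).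
    assert (tau ^ 2 <= t ^ 2) by (apply pow_incr; lra).
    rewrite <- Htaulam, Rpow_mult_distr.
    replace (tau ^ 2 * lam ^ 2 / 4) with (tau ^ 2 / 4 * lam ^ 2) by field.
    apply Rmult_le_compat_r; [apply pow2_ge_0|lra]. }
  assert (HFl : forall t, tau <= t <= th0 -> lam * (16 / eta) <= F (1 - cos t)).
  { intros t Ht.
    assert (U := one_minus_cos_upper t ltac:(lra)).
    assert (S := Hs t); assert (Sl := Hsl t Ht); set (s := 1 - cos t) in *.
    assert (Hss0 : s <= s0) by (assert (t ^ 2 <= th0 ^ 2) by (apply pow_incr; lra); lra).
    assert (M := mean_value_le (fun u => - F u) (fun u => - F' u) 0 s (- (c * lam ^ 3)) ltac:(lra)).
    assert (M' : - F s - - F 0 <= - (c * lam ^ 3) * (s - 0)).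
    { apply M; intros u Hu.
      - apply (is_derive_opp F), HF; lra.
      - apply Ropp_le_contravar, HF1; lra. }
    assert (c * lam ^ 3 * s >= lam * (c * T ^ 2 / 4)).
    { replace (c * lam ^ 3 * s) with (lam * c * (s * lam ^ 2)) by ring.
      replace (lam * (c * T ^ 2 / 4)) with (lam * c * (T ^ 2 / 4)) by field.
      apply Rle_ge, Rmult_le_compat_l; [apply Rmult_le_pos|]; lra. }
    assert (lam * (C + 16 / eta) <= lam * (c * T ^ 2 / 4)) by (apply Rmult_le_compat_l; lra).
    lra. }
  assert (Hl16 : 0 < lam * (16 / eta)) by (apply Rmult_lt_0_compat; lra).
  assert (P3 : Rabs (RInt f tau th0)
     <= 2 * (exp (g (1 - cos tau)) / F (1 - cos tau))).
  { apply (oscillatory_bound f (fun t => exp (g (1 - cos t)) / F (1 - cos t))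
      (fun t => sin t * (exp (g (1 - cos t)) * (G (1 - cos t) * F (1 - cos t) - F' (1 - cos t)))
                / F (1 - cos t) ^ 2)
      phi (fun t => F (1 - cos t))).
    - exact Htau.
    - exact Hcont.
    - intros t Ht.
      assert (HFp := HFl t Ht).
      assert (Dg := Hg _ (Hs t)); assert (DF := HF _ (Hs t)).
      assert (Dc : is_derive (fun t => 1 - cos t) t (sin t)) by (auto_derive; [trivial|ring]).
      assert (Dg' := is_derive_comp g (fun t => 1 - cos t) t _ _ Dg Dc).
      assert (DF' := is_derive_comp F (fun t => 1 - cos t) t _ _ DF Dc).
      assert (De := is_derive_comp exp (fun t => g (1 - cos t)) t _ _ (is_derive_exp _) Dg').
      evar_last; [apply (is_derive_div _ _ _ _ _ De DF'); lra|].
      unfold scal; simpl; unfold mult; simpl; field; lra.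
    - intros t Ht; apply Hphi.
    - intros t Ht.
      assert (HFp := HFl t Ht); assert (Sl := Hsl t Ht).
      assert (S := Hs t).
      assert (U := one_minus_cos_upper t ltac:(lra)).
      assert (HGn : G (1 - cos t) <= 0).
      { eapply Rle_trans; [apply HG1, Hs|]; set (s := 1 - cos t) in *.
        replace (- c * lam ^ 3 * s + C * lam) with (- (lam * (c * (s * lam ^ 2) - C))) by ring.
        assert (c * (T ^ 2 / 4) <= c * (s * lam ^ 2)) by (apply Rmult_le_compat_l; lra).
        assert (0 <= lam * (c * (s * lam ^ 2) - C)) by (apply Rmult_le_pos; lra). lra. }
      assert (HF'p : c * lam ^ 3 <= F' (1 - cos t)) by (apply HF1; [assert (t ^ 2 <= th0 ^ 2) by (apply pow_incr; lra)|]; lra).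
      assert (0 < c * lam ^ 3) by (apply Rmult_lt_0_compat; lra).
      assert (Hsin : 0 <= sin t) by (apply sin_ge_0; lra).
      assert (Hexp := exp_pos (g (1 - cos t))).
      assert (0 < / F (1 - cos t) ^ 2) by (apply Rinv_0_lt_compat, pow_lt; lra).
      assert (HX0 : G (1 - cos t) * F (1 - cos t) - F' (1 - cos t) <= 0) by (assert (0 <= - G (1 - cos t) * F (1 - cos t)) by (apply Rmult_le_pos; lra); lra).
      assert (HP0 : 0 <= sin t * exp (g (1 - cos t)) * / F (1 - cos t) ^ 2)
        by (repeat apply Rmult_le_pos; lra).
      unfold Rdiv.
      replace (sin t * (exp (g (1 - cos t)) * (G (1 - cos t) * F (1 - cos t) - F' (1 - cos t))) * / F (1 - cos t) ^ 2)
        with (sin t * exp (g (1 - cos t)) * / F (1 - cos t) ^ 2 * (G (1 - cos t) * F (1 - cos t) - F' (1 - cos t))) by ring.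
      assert (Z := Rmult_le_compat_l _ _ _ HP0 HX0); lra.
    - intros t Ht; assert (HFp := HFl t Ht); unfold f; field; lra.
    - assert (HFp := HFl tau ltac:(lra)).
      apply Rlt_le, Rdiv_lt_0_compat; [apply exp_pos|lra].
    - assert (HFp := HFl th0 ltac:(lra)).
      apply Rlt_le, Rdiv_lt_0_compat; [apply exp_pos|lra]. }
  assert (P3' : lam * (2 * (exp (g (1 - cos tau)) / F (1 - cos tau))) <= eta / 4).
  { assert (HFp := HFl tau ltac:(lra)).
    assert (A1 := Hgs tau ltac:(lra)).
    assert (A3 := exp_minus_one_bound _ (Rle_trans _ _ _ A1 Hgh)).
    assert (E2 : exp (g (1 - cos tau)) <= 2).
    { apply Rabs_le_between in A3; lra. }
    apply Rle_trans with (lam * (2 * (2 / (lam * (16 / eta))))); [|right; field; lra].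
    apply Rmult_le_compat_l; [lra|]; apply Rmult_le_compat_l; [lra|].
    apply Rmult_le_compat; [apply Rlt_le, exp_pos| |exact E2|].
    - apply Rlt_le, Rinv_0_lt_compat; lra.
    - apply Rinv_le_contravar; lra. }
  (* Integrating the bound on G gives g <= - Y beyond th0, with
     Y of order lam^3; here exp(-Y) <= 1/Y already suffices. *)
  set (Y := lam * (del * lam ^ 2 - 2 * C)).
  assert (Hdl : 2 * C + 16 / eta <= del * lam ^ 2).
  { assert (L : (2 * C + 16 / eta) / del <= lam) by (unfold Lam in *; lra).
    apply Rle_trans with (del * ((2 * C + 16 / eta) / del)); [right; field; lra|].
    apply Rmult_le_compat_l; [lra|].
    assert (lam * 1 <= lam * lam) by (apply Rmult_le_compat_l; lra); lra. }
  assert (P4 : Rabs (RInt f th0 PI) <= (PI - th0) * exp (- Y)).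
  { apply abs_RInt_le_const; [lra|apply ex_RInt_of_continuous, Hcont|].
    intros t Ht; unfold f; rewrite Rabs_mult, (Rabs_pos_eq (exp _)) by apply Rlt_le, exp_pos.
    assert (A5 : Rabs (cos (phi t)) <= 1) by (apply Rabs_le, COS_bound).
    apply Rle_trans with (exp (g (1 - cos t)) * 1).
    { apply Rmult_le_compat_l; [apply Rlt_le, exp_pos|exact A5]. }
    rewrite Rmult_1_r; apply exp_nondecreasing.
    assert (Hcos : cos t <= cos th0).
    { destruct (Req_dec t th0) as [->|Hne]; [lra|].
      apply Rlt_le, cos_decreasing_1; lra. }
    assert (Q : th0 ^ 2 / 4 <= 1 - cos t) 
      by (assert (L := one_minus_cos_quarter th0 ltac:(lra)); lra).
    assert (S := Hs t); set (s := 1 - cos t) in *.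
    assert (M := mean_value_le (fun u => g u + c * lam ^ 3 * u ^ 2 / 2 - C * lam * u)
       (fun u => G u + c * lam ^ 3 * u - C * lam) 0 s 0 ltac:(lra)).
    assert (M' : (g s + c * lam ^ 3 * s ^ 2 / 2 - C * lam * s)
       - (g 0 + c * lam ^ 3 * 0 ^ 2 / 2 - C * lam * 0) <= 0 * (s - 0)).
    { apply M; intros u Hu.
      - evar_last.
        + apply (is_derive_minus (fun u => g u + c * lam ^ 3 * u ^ 2 / 2) (fun u => C * lam * u)).
          apply (is_derive_plus g (fun u => c * lam ^ 3 * u ^ 2 / 2)); [apply Hg; lra|].
          auto_derive; [trivial|reflexivity]. auto_derive; [trivial|reflexivity].
        + unfold minus, plus, opp; simpl; field.
      - assert (Z := HG1 u ltac:(lra)); lra. }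
    rewrite Hg0 in M'.
    assert (Q2 : (th0 ^ 2 / 4) ^ 2 <= s ^ 2) by (apply pow_incr; split; [|exact Q];
      apply Rlt_le, Rdiv_lt_0_compat; [apply pow_lt|]; lra).
    assert (Q3 : lam ^ 3 * del <= c * lam ^ 3 * s ^ 2 / 2).
    { unfold del; replace (lam ^ 3 * (c * (th0 ^ 2 / 4) ^ 2 / 2))
        with (c * lam ^ 3 * (th0 ^ 2 / 4) ^ 2 / 2) by field.
      unfold Rdiv at 1 3; apply Rmult_le_compat_r; [lra|].
      apply Rmult_le_compat_l; [apply Rmult_le_pos; lra|exact Q2]. }
    assert (Q4 : C * lam * s <= C * lam * 2) by (apply Rmult_le_compat_l; [apply Rmult_le_pos|]; lra).
    unfold Y; replace (- (lam * (del * lam ^ 2 - 2 * C)))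
      with (- (lam ^ 3 * del) + C * lam * 2) by ring.
    lra. }
  assert (P4' : lam * ((PI - th0) * exp (- Y)) <= eta / 4).
  { assert (HYe : lam * (16 / eta) <= Y) by (unfold Y; apply Rmult_le_compat_l; lra).
    assert (E1 : exp (- Y) <= / Y).
    { rewrite exp_Ropp; apply Rinv_le_contravar; [lra|].
      assert (Z := exp_ineq1_le Y); lra. }
    assert (E2 : / Y <= / (lam * (16 / eta))) by (apply Rinv_le_contravar; lra).
    apply Rle_trans with (lam * (4 * / (lam * (16 / eta)))); [|right; field; lra].
    apply Rmult_le_compat_l; [lra|].
    apply Rmult_le_compat; [lra|apply Rlt_le, exp_pos|lra|lra]. }
  assert (Esum : (RInt f 0 PI : R) = RInt f 0 tau + RInt f tau th0 + RInt f th0 PI).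
  { rewrite (RInt_Chasles_R f 0 th0 PI), (RInt_Chasles_R f 0 tau th0); trivial. }
  rewrite Esum.
  set (I1 := RInt f 0 tau : R) in *; set (I2 := RInt f tau th0 : R) in *.
  set (I3 := RInt f th0 PI : R) in *.
  set (J := RInt (fun t => cos (k ^ 3 * lam ^ 3 * t ^ 3 / 3 + b * lam * t)) 0 tau : R) in *.
  set (A := / k * (PI * Airy (b / k))) in *.
  assert (Hm : forall z e, Rabs z <= e -> lam * e <= eta / 4 -> Rabs (lam * z) <= eta / 4).
  { intros z e Hz He; rewrite Rabs_mult, (Rabs_pos_eq lam) by lra.
    eapply Rle_trans; [|exact He]; apply Rmult_le_compat_l; lra. }
  assert (F2 := Hm _ _ P2 P2'); assert (F3 := Hm _ _ P3 P3'); assert (F4 := Hm _ _ P4 P4').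
  replace (lam * (I1 + I2 + I3) - A) with (lam * (I1 - J) + lam * I2 + lam * I3 + (lam * J - A)) by ring.
  apply Rabs_le_between in F2; apply Rabs_le_between in F3.
  apply Rabs_le_between in F4; apply Rabs_le_between in P1.
  clearbody I1 I2 I3 J A.
  apply Rabs_le; lra.
Qed.

(** * Modulus and phase on the circle through the saddle *)

(** [norm2] as an affine function of s = 1 - cos theta. *)
Definition dist2 (t s : R) : R := (1 - t) ^ 2 + 2 * t * s.

Lemma norm2_dist2 : forall theta t, norm2 theta t = dist2 t (1 - cos theta).
Proof.
  intros theta t; unfold norm2, dist2.
  assert (E := sin2_cos2 theta); unfold Rsqr in E.
  transitivity (1 - 2 * t * cos theta + t ^ 2 * (sin theta * sin theta + cos theta * cos theta));
    [ring|rewrite E; ring].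
Qed.

Lemma dist2_bounds : forall t s h, 0 <= t -> 0 < h -> h <= 1 - t -> 0 <= s <= 2 ->
  h ^ 2 <= dist2 t s <= 4.
Proof.
  intros t s h Ht Hh Hth Hs; unfold dist2; split; [|nra].
  assert (h ^ 2 <= (1 - t) ^ 2) by (apply pow_incr; lra).
  assert (0 <= t * s) by nra; lra.
Qed.

Definition log_amplitude (x M p r s : R) : R :=
  x * (ln (dist2 r s) / 2) - M * (ln (dist2 (p * r) s) / 2).

Definition log_amplitude' (x M p r s : R) : R :=
  x * r / dist2 r s - M * (p * r) / dist2 (p * r) s.

Definition phase (x M nu p r theta : R) : R :=
  - x * angle theta r + M * angle theta (p * r) - nu * theta.

(** Derivative of [phase] in theta, as a function of s = 1 - cos theta. *)
Definition phase_speed (x M nu p r s : R) : R :=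
  - x * ((r * (1 - s) - r ^ 2) / dist2 r s)
  + M * ((p * r * (1 - s) - (p * r) ^ 2) / dist2 (p * r) s) - nu.

Definition phase_speed' (x M p r s : R) : R :=
  x * (r * (1 - r ^ 2)) / dist2 r s ^ 2
  - M * (p * r * (1 - (p * r) ^ 2)) / dist2 (p * r) s ^ 2.

Lemma is_derive_log_amplitude : forall x M p r s,
  0 < dist2 r s -> 0 < dist2 (p * r) s ->
  is_derive (log_amplitude x M p r) s (log_amplitude' x M p r s).
Proof.
  intros x M p r s H1 H2; unfold log_amplitude, log_amplitude', dist2 in *.
  auto_derive; [split; [|split; [|trivial]]; assumption|].
  field; simpl in *; split; lra.
Qed.

Lemma is_derive_phase : forall x M nu p r theta, 0 < p < 1 -> 0 < r < 1 ->
  is_derive (phase x M nu p r) theta (phase_speed x M nu p r (1 - cos theta)).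
Proof.
  intros x M nu p r theta Hp Hr.
  assert (A1 := is_derive_angle_theta r theta ltac:(lra)).
  assert (A2 := is_derive_angle_theta (p * r) theta ltac:(nra)).
  assert (E1 : Derive (fun u : R => angle u r) theta = _) by exact (is_derive_unique _ _ _ A1).
  assert (E2 : Derive (fun u : R => angle u (p * r)) theta = _) by exact (is_derive_unique _ _ _ A2).
  unfold phase; auto_derive; [split; [|split; [|trivial]]; eexists; eassumption|].
  rewrite E1, E2, !norm2_dist2; unfold phase_speed, Rdiv; ring.
Qed.

Lemma is_derive_phase_speed : forall x M nu p r s,
  0 < dist2 r s -> 0 < dist2 (p * r) s ->
  is_derive (phase_speed x M nu p r) s (phase_speed' x M p r s).
Proof.
  intros x M nu p r s H1 H2; unfold phase_speed, phase_speed', dist2 in *.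
  auto_derive; [split; [lra|split; [lra|trivial]]|].
  field; simpl in *; split; lra.
Qed.

(** The exponents for which v = - r is a double saddle point, parametrised
    by r and a scale m so that they are rational.  With N = lam^3 the leading
    terms are N Y, N (1 - z) and N z, where Y = m (1-r)^2/r,
    1 - z = m (1-pr)^2/(pr) and z = m (1-p) r; in [saddle_x], beta shifts Y off
    the double saddle. *)
Definition saddle_x (r m lam beta : R) : R := lam ^ 3 * (m * (1 - r) ^ 2 / r) - beta * lam.

Definition saddle_M (p r m lam : R) : R := lam ^ 3 * (m * (1 - p * r) ^ 2 / (p * r)) + 1.

Definition saddle_n (p r m lam : R) : R := lam ^ 3 * (m * (1 - p) * r).

(** At the double saddle the terms of order lam^3 cancel at s = 0 and
    leave a multiple of - s, which produces the maximum of the modulus. *)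
Lemma log_amplitude'_saddle : forall p r m lam beta s,
  0 < p -> 0 < r -> 0 < dist2 r s -> 0 < dist2 (p * r) s ->
  log_amplitude' (saddle_x r m lam beta) (saddle_M p r m lam) p r s
  = - (2 * (lam ^ 3 * s) * (m * r * (1 - p) * (1 - p * r ^ 2)) * (/ dist2 r s * / dist2 (p * r) s))
    - beta * lam * (r * / dist2 r s) - p * r * / dist2 (p * r) s.
Proof.
  intros p r m lam beta s Hp Hr H1 H2.
  unfold log_amplitude', saddle_x, saddle_M.
  apply (Rmult_eq_reg_r (dist2 r s * dist2 (p * r) s)); [|apply Rgt_not_eq, Rmult_lt_0_compat; lra].
  transitivity ((lam ^ 3 * (m * (1 - r) ^ 2) - beta * lam * r) * dist2 (p * r) s
     - (lam ^ 3 * (m * (1 - p * r) ^ 2) + p * r) * dist2 r s); [field; lra|].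
  transitivity (- (2 * (lam ^ 3 * s) * (m * r * (1 - p) * (1 - p * r ^ 2)))
    - beta * lam * r * dist2 (p * r) s - p * r * dist2 r s); [unfold dist2; ring|field; lra].
Qed.

(** The phase speed starts with a term linear in s, that is quadratic in
    theta, and the beta term; every other term is of lower order when
    theta = O(1/lam). *)
Lemma phase_speed_saddle : forall p r m lam beta s,
  0 < p -> 0 < r -> r < 1 -> p * r < 1 -> 0 < dist2 r s -> 0 < dist2 (p * r) s ->
  phase_speed (saddle_x r m lam beta) (saddle_M p r m lam) (saddle_n p r m lam) p r s
  - (2 * (m * r * (1 - p) / ((1 - r) * (1 - p * r))) * lam ^ 3 * s + beta * (r / (1 - r)) * lam)
  = lam ^ 3 * s ^ 2 * m * 2 *
      (p * r * (1 - (p * r) ^ 2) * / (1 - p * r) ^ 2 * / dist2 (p * r) s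
       - r * (1 - r ^ 2) * / (1 - r) ^ 2 * / dist2 r s)
    - beta * lam * s * (2 * r ^ 2 * / (1 - r) * / dist2 r s + r * / dist2 r s)
    + (p * r * (1 - s) - (p * r) ^ 2) * / dist2 (p * r) s.
Proof.
  intros p r m lam beta s Hp Hr Hr1 Hpr H1 H2.
  unfold phase_speed, saddle_x, saddle_M, saddle_n.
  unfold dist2 in *; field; repeat split; lra.
Qed.

Lemma phase_speed'_saddle : forall p r m lam beta s,
  0 < p -> 0 < r -> 0 < dist2 r s -> 0 < dist2 (p * r) s ->
  phase_speed' (saddle_x r m lam beta) (saddle_M p r m lam) p r s
  = lam ^ 3 * (m * ((1 - r) ^ 2 * (1 - r ^ 2) / dist2 r s ^ 2
        - (1 - p * r) ^ 2 * (1 - (p * r) ^ 2) / dist2 (p * r) s ^ 2))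
    - beta * lam * (r * (1 - r ^ 2) * / dist2 r s ^ 2)
    - p * r * (1 - (p * r) ^ 2) * / dist2 (p * r) s ^ 2.
Proof.
  intros p r m lam beta s Hp Hr H1 H2.
  unfold phase_speed', saddle_x, saddle_M; field; repeat split; lra.
Qed.

(** At s = 0 the right-hand side is (1+r)/(1-r) - (1+pr)/(1-pr) =
    2 r (1-p) / ((1-r)(1-pr)).  Half of it survives for s up to
    (1-p) h^2/8, which keeps the phase speed increasing there. *)
Lemma speed_gap : forall p r h s, 0 < p < 1 -> 0 < r < 1 -> 0 < h -> h <= 1 - r ->
  0 <= s <= (1 - p) * h ^ 2 / 8 ->
  r * (1 - p) <= (1 - r) ^ 2 * (1 - r ^ 2) / dist2 r s ^ 2
        - (1 - p * r) ^ 2 * (1 - (p * r) ^ 2) / dist2 (p * r) s ^ 2.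
Proof.
  intros p r h s Hp Hr Hh Hhr Hs.
  assert (Hpr : 0 < p * r < r) by nra.
  set (D := (1 - r) ^ 2).
  assert (HD : 0 < D) by (apply pow_lt; lra).
  assert (HhD : h ^ 2 <= D) by (apply pow_incr; lra).
  set (v := 2 * r * s / D).
  assert (Hv : 0 <= v <= r * (1 - p) / 4).
  { split; [apply Rmult_le_pos; [nra|apply Rlt_le, Rinv_0_lt_compat, HD]|].
    apply Rmult_le_reg_r with D; [exact HD|].
    replace (v * D) with (2 * r * s) by (unfold v; field; lra).
    assert (s <= (1 - p) * D / 8) by nra. nra. }
  assert (Ed : dist2 r s = D * (1 + v)) by (unfold dist2, v; fold D; field; lra).
  assert (A1 : (1 + r - r * (1 - p)) / (1 - r) <= (1 - r) ^ 2 * (1 - r ^ 2) / dist2 r s ^ 2).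
  { rewrite Ed.
    replace ((1 - r) ^ 2 * (1 - r ^ 2) / (D * (1 + v)) ^ 2)
      with ((1 + r) * / (1 + v) ^ 2 * / (1 - r)) by (unfold D; field; lra).
    unfold Rdiv; apply Rmult_le_compat_r; [apply Rlt_le, Rinv_0_lt_compat; lra|].
    assert (1 - 2 * v <= / (1 + v) ^ 2).
    { apply Rmult_le_reg_r with ((1 + v) ^ 2); [apply pow_lt; lra|].
      rewrite Rinv_l by (apply pow_nonzero; lra).
      assert (0 <= v ^ 2) by nra. assert (0 <= v ^ 3) by (apply pow_le; lra). nra. }
    nra. }
  assert (A2 : (1 - p * r) ^ 2 * (1 - (p * r) ^ 2) / dist2 (p * r) s ^ 2 <= (1 + p * r) / (1 - p * r)).
  { replace ((1 + p * r) / (1 - p * r))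
      with ((1 - p * r) ^ 2 * (1 - (p * r) ^ 2) / ((1 - p * r) ^ 2) ^ 2) by (field; nra).
    unfold Rdiv; apply Rmult_le_compat_l.
    - apply Rmult_le_pos; [apply pow_le; lra|nra].
    - apply Rinv_le_contravar; [apply pow_lt, pow_lt; lra|].
      apply pow_incr; split; [apply pow_le; lra|]; unfold dist2; nra. }
  assert (A3 : (1 + r - r * (1 - p)) / (1 - r) - (1 + p * r) / (1 - p * r)
     = r * (1 - p) * (/ (1 - r) * (2 * / (1 - p * r) - 1))) by (field; lra).
  assert (A4 : 1 <= / (1 - r)) by (rewrite <- Rinv_1 at 1; apply Rinv_le_contravar; lra).
  assert (A5 : 1 <= / (1 - p * r)) by (rewrite <- Rinv_1 at 1; apply Rinv_le_contravar; lra).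
  assert (A6 : 1 <= / (1 - r) * (2 * / (1 - p * r) - 1)) by nra.
  assert (A7 : r * (1 - p) * 1 <= r * (1 - p) * (/ (1 - r) * (2 * / (1 - p * r) - 1)))
    by (apply Rmult_le_compat_l; nra).
  fold D in A1; lra.
Qed.

(** [airy_asymptotics] for the concrete modulus and phase.  The quantities
    h = 1 - r2 and kap = m1 r1 (1-p) bound all denominators and the leading
    coefficients from below, and w = h^(-4) absorbs the former. *)
Lemma saddle_asymptotics : forall p r1 r2 m1 m2 B eta,
  0 < p < 1 -> 0 < r1 -> r2 < 1 -> 0 < m1 -> 0 <= B -> 0 < eta ->
  exists Lam, 1 <= Lam /\ forall r m beta lam k,
  r1 <= r <= r2 -> m1 <= m <= m2 -> Rabs beta <= B -> Lam <= lam ->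
  0 < k -> k ^ 3 = m * r * (1 - p) / ((1 - r) * (1 - p * r)) ->
  let x := saddle_x r m lam beta in
  let M := saddle_M p r m lam in
  Rabs (lam * (exp (- log_amplitude x M p r 0)
               * RInt (contour_integrand x M (saddle_n p r m lam) p r) 0 PI)
        - / k * (PI * Airy (beta * (r / (1 - r)) / k))) <= eta.
Proof.
  intros p r1 r2 m1 m2 B eta Hp Hr1 Hr2 Hm1 HB Heta.
  destruct (Rle_lt_dec r1 r2) as [Hr12|Hr12];
    [|exists 1; split; [lra|]; intros r m beta lam k Hr; exfalso; lra].
  destruct (Rle_lt_dec m1 m2) as [Hm12|Hm12];
    [|exists 1; split; [lra|]; intros r m beta lam k Hr Hm; exfalso; lra].
  set (h := 1 - r2).
  assert (Hh : 0 < h < 1) by (unfold h; lra).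
  set (w := / h ^ 4).
  assert (Hh4 : 0 < h ^ 4) by (apply pow_lt; lra).
  assert (Hw2 : / h ^ 2 <= w).
  { apply Rinv_le_contravar; [exact Hh4|]; replace (h ^ 4) with (h ^ 2 * h ^ 2) by ring.
    assert (0 < h ^ 2 <= 1) by nra; nra. }
  assert (Hw1 : 1 <= / h ^ 2) by (rewrite <- Rinv_1 at 1; apply Rinv_le_contravar; nra).
  set (kap := m1 * r1 * (1 - p)).
  assert (Hkap : 0 < kap) by (unfold kap; repeat apply Rmult_lt_0_compat; lra).
  set (c := Rmin 1 (kap * h / 8)).
  set (C := 1 + (4 * m2 + 3 * B + 3) * w).
  assert (Hc : 0 < c <= 1).
  { split; [apply Rmin_glb_lt; [lra|nra]|apply Rmin_l]. }
  assert (Hck : c <= kap * h / 8) by apply Rmin_r.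
  assert (HBw : 0 <= B * w) by (apply Rmult_le_pos; lra).
  assert (Hmw : 0 <= m2 * w) by (apply Rmult_le_pos; lra).
  assert (HC : 1 <= C) by (unfold C; lra).
  assert (Hck8 : c <= kap / 8) by (clear - Hck Hkap Hh; clearbody c; nra).
  set (s0 := (1 - p) * h ^ 2 / 8).
  assert (Hs0 : 0 < s0) by (unfold s0; assert (0 < h ^ 2) by (apply pow_lt; lra); nra).
  destruct (airy_asymptotics c C s0 eta Hc HC Hs0 Heta) as [Lam [HLam HA]].
  (* For lam >= Lam2 the terms of order at most lam in the derivative of the phase
     speed are at most half of its leading term. *)
  set (Lam2 := 2 * (B + 1) * w / kap).
  assert (HLam2 : 0 < Lam2) by (unfold Lam2; apply Rdiv_lt_0_compat; nra).
  exists (Lam + Lam2); split; [lra|].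
  intros r m beta lam k Hr Hm Hbeta Hlam Hk Hk3 x M.
  assert (Hl1 : 1 <= lam) by lra.
  assert (Hl3 : 0 < lam ^ 3) by (apply pow_lt; lra).
  assert (Hpr : 0 < p * r < r) by (clear - Hp Hr Hr1; nra).
  assert (Hpp : 0 <= (p * r) ^ 2 <= p * r) by (clear - Hpr Hr Hr2; nra).
  assert (Hrr : 0 <= r ^ 2 <= r) by (clear - Hpr Hr Hr2; nra).
  assert (Hpr2 : 0 <= p * r ^ 2 <= r) by (clear - Hp Hrr; nra).
  assert (Hpr3 : 0 <= p * r * (1 - (p * r) ^ 2) <= 1) by (clear - Hpr Hpp Hr Hr2; nra).
  assert (Hr3 : 0 <= r * (1 - r ^ 2) <= 1) by (clear - Hpr Hrr Hr Hr2; nra).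
  assert (Hd : forall s, 0 <= s <= 2 ->
     (0 < dist2 r s /\ 0 < dist2 (p * r) s) /\
     / 4 <= / dist2 r s <= / h ^ 2 /\ / 4 <= / dist2 (p * r) s <= / h ^ 2).
  { intros s Hs.
    assert (A := dist2_bounds r s h ltac:(lra) ltac:(lra) ltac:(unfold h; lra) Hs).
    assert (A' := dist2_bounds (p * r) s h ltac:(lra) ltac:(lra) ltac:(unfold h; lra) Hs).
    assert (Hh2 : 0 < h ^ 2) by (apply pow_lt; lra).
    split; [split; lra|]; repeat split; apply Rinv_le_contravar; lra. }
  assert (Hmrq : kap <= m * r * (1 - p) <= m2).
  { assert (0 < m) by lra. split.
    - unfold kap; apply Rmult_le_compat_r; [lra|]; apply Rmult_le_compat; lra.
    - apply Rle_trans with (m * (r * (1 - p))); [lra|].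
      apply Rle_trans with (m * 1); [apply Rmult_le_compat_l; [lra|]|lra].
      clear - Hp Hpr Hr Hr2; nra. }
  assert (Hir : 1 <= / (1 - r) <= / h).
  { split; [rewrite <- Rinv_1 at 1|]; apply Rinv_le_contravar; unfold h in *; lra. }
  assert (Hipr : 1 <= / (1 - p * r) <= / h).
  { split; [rewrite <- Rinv_1 at 1|]; apply Rinv_le_contravar; unfold h in *; lra. }
  assert (Hhh : / h * / h = / h ^ 2) by (field; lra).
  assert (Hww : / h ^ 2 * / h ^ 2 = w) by (unfold w; field; lra).
  assert (Hih : 1 <= / h) by lra.
  assert (Hih2 : / h <= / h ^ 2) by (rewrite <- Hhh; apply le_scale_up; lra).
  set (g := fun s => log_amplitude x M p r s - log_amplitude x M p r 0).
  assert (Hpt : forall t, exp (- log_amplitude x M p r 0) * contour_integrand x M (saddle_n p r m lam) p r t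
     = exp (g (1 - cos t)) * cos (phase x M (saddle_n p r m lam) p r t)).
  { intros t.
    transitivity (exp (- log_amplitude x M p r 0)
      * (exp (log_amplitude x M p r (1 - cos t)) * cos (phase x M (saddle_n p r m lam) p r t))).
    - unfold contour_integrand; rewrite !norm2_dist2; reflexivity.
    - unfold g, Rminus; rewrite exp_plus; ring. }
  replace (exp (- log_amplitude x M p r 0) * _)
    with (RInt (fun t => exp (g (1 - cos t)) * cos (phase x M (saddle_n p r m lam) p r t)) 0 PI).
  2:{ rewrite <- (RInt_ext _ _ _ _ (fun t _ => Hpt t)).
      apply (RInt_scal (V := R_CompleteNormedModule) (contour_integrand x M (saddle_n p r m lam) p r)
        0 PI (exp (- log_amplitude x M p r 0))).
      apply ex_RInt_of_continuous; intros t; apply contour_integrand_continuous; lra. }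
  apply (HA lam k (beta * (r / (1 - r))) g (log_amplitude' x M p r)
    (phase x M (saddle_n p r m lam) p r) (phase_speed x M (saddle_n p r m lam) p r)
    (phase_speed' x M p r)); clear HA.
  - lra.
  - exact Hk.
  - rewrite Hk3; unfold Rdiv; rewrite Rinv_mult.
    assert (Z : 1 <= / (1 - r) * / (1 - p * r) <= / h ^ 2) by (rewrite <- Hhh; split; [|apply Rmult_le_compat; lra];
      apply Rle_trans with (1 * 1); [lra|apply Rmult_le_compat; lra]).
    split; [apply Rle_trans with (kap * 1); [lra|apply Rmult_le_compat; lra]|]; apply Rle_trans with (m2 * / h ^ 2); [apply Rmult_le_compat; lra|].
    assert (m2 * / h ^ 2 <= m2 * w) by (apply Rmult_le_compat_l; lra).
    unfold C; lra.
  - apply Rle_trans with (B * (1 * / h)); [|assert (B * / h <= B * w) by (apply Rmult_le_compat_l; lra); unfold C; lra].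
    apply Rabs_mult_le; [exact Hbeta|]; apply Rabs_mult_le; apply Rabs_le; lra.
  - unfold g; ring.
  - unfold phase, angle; rewrite sin_0, cos_0, !Rmult_0_r.
    unfold Rdiv; rewrite !Rmult_0_l, atan_0; ring.
  - intros s Hs; destruct (Hd s Hs) as [[D1 D2] _].
    evar_last.
    + apply (is_derive_minus (log_amplitude x M p r) (fun _ => log_amplitude x M p r 0)).
      apply is_derive_log_amplitude; assumption. apply is_derive_const.
    + apply (minus_zero_r (G := R_AbelianGroup)).
  - intros t; apply is_derive_phase; lra.
  - intros s Hs; destruct (Hd s Hs) as [[D1 D2] _]; apply is_derive_phase_speed; assumption.
  - intros t.
    apply (continuous_ext (fun t => exp (- log_amplitude x M p r 0)
       * contour_integrand x M (saddle_n p r m lam) p r t)); [exact Hpt|].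
    apply (continuous_scal_r (V := R_NormedModule) (exp (- log_amplitude x M p r 0))
      (contour_integrand x M (saddle_n p r m lam) p r)).
    apply contour_integrand_continuous; lra.
  - intros s Hs; destruct (Hd s Hs) as [[D1 D2] [I1 I2]].
    unfold x, M; rewrite log_amplitude'_saddle by lra.
    set (i1 := / dist2 r s) in *; set (i2 := / dist2 (p * r) s) in *.
    assert (Z1 : kap * h / 16 <= m * r * (1 - p) * (1 - p * r ^ 2) * (i1 * i2)).
    { unfold Rdiv; apply Rmult_le_compat; [apply Rmult_le_pos; lra|lra| |].
      - apply Rmult_le_compat; [lra|lra|lra|]; unfold h; lra.
      - apply Rle_trans with (/ 4 * / 4); [lra|apply Rmult_le_compat; lra]. }
    assert (Z2 : - (beta * lam * (r * i1)) <= C * lam).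
    { apply Rle_trans with (1 := Rle_abs _); rewrite Rabs_Ropp.
      apply Rle_trans with (B * lam * (1 * / h ^ 2)).
      - apply Rabs_mult_le; [apply Rabs_mult_le; [exact Hbeta|apply Rabs_le; lra]|].
        apply Rabs_mult_le; apply Rabs_le; lra.
      - replace (B * lam * (1 * / h ^ 2)) with (B * / h ^ 2 * lam) by ring.
        apply Rmult_le_compat_r; [lra|].
        assert (B * / h ^ 2 <= B * w) by (apply Rmult_le_compat_l; lra).
        unfold C; lra. }
    assert (Z3 : 0 <= p * r * i2) by (apply Rmult_le_pos; lra).
    assert (Z4 : 0 <= lam ^ 3 * s) by (apply Rmult_le_pos; lra).
    assert (Z5 := Rmult_le_compat_l _ _ _ Z4 Z1).
    assert (Z6 := Rmult_le_compat_l _ _ _ Z4 Hck); lra.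
  - intros s Hs; destruct (Hd s Hs) as [[D1 D2] [I1 I2]].
    unfold x, M; rewrite log_amplitude'_saddle by lra.
    set (i1 := / dist2 r s) in *; set (i2 := / dist2 (p * r) s) in *.
    assert (Z4 : 0 <= lam ^ 3 * s) by (apply Rmult_le_pos; lra).
    apply Rle_trans with (2 * (lam ^ 3 * s) * (m2 * 1) * (/ h ^ 2 * / h ^ 2)
      + B * lam * (1 * / h ^ 2) + 1 * / h ^ 2).
    + apply Rabs_minus_le; [apply Rabs_minus_le|].
      * rewrite Rabs_Ropp; apply Rabs_mult_le; [|apply Rabs_mult_le; apply Rabs_le; lra].
        apply Rabs_mult_le; [apply Rabs_le; lra|].
        apply Rabs_mult_le; apply Rabs_le; lra.
      * apply Rabs_mult_le; [apply Rabs_mult_le; [exact Hbeta|apply Rabs_le; lra]|].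
        apply Rabs_mult_le; apply Rabs_le; lra.
      * apply Rabs_mult_le; apply Rabs_le; lra.
    + rewrite Hww; unfold C.
      assert (Y1 : 0 <= lam ^ 3 * s * w) by (apply Rmult_le_pos; lra).
      assert (Y2 : B * lam * (1 * / h ^ 2) <= B * lam * w) by (apply Rmult_le_compat_l; [apply Rmult_le_pos|]; lra).
      assert (Y3 : 0 <= B * w) by exact HBw.
      assert (Y4 : 0 <= m2 * w) by exact Hmw.
      assert (Y5 : w <= w * lam) by (rewrite Rmult_comm; apply le_scale_up; lra).
      assert (Y6 : 0 <= B * w * (lam ^ 3 * s)) by (apply Rmult_le_pos; lra).
      assert (Y7 : 0 <= m2 * w * (lam ^ 3 * s)) by (apply Rmult_le_pos; lra).
      assert (Y8 : 0 <= m2 * w * lam) by (apply Rmult_le_pos; lra).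
      assert (Y9 : 0 <= B * w * lam) by (apply Rmult_le_pos; lra).
      lra.
  - intros s Hs Hs2; destruct (Hd s ltac:(lra)) as [[D1 D2] [I1 I2]].
    unfold x, M; rewrite phase_speed'_saddle by lra.
    assert (Gap := speed_gap p r h s Hp ltac:(lra) ltac:(lra) ltac:(unfold h; lra) Hs).
    set (gap := (1 - r) ^ 2 * (1 - r ^ 2) / dist2 r s ^ 2 - _) in *.
    rewrite <- !pow_inv.
    set (i1 := / dist2 r s) in *; set (i2 := / dist2 (p * r) s) in *.
    assert (S1 : 0 <= i1 ^ 2 <= w).
    { split; [apply pow2_ge_0|]; rewrite <- Hww; replace (i1 ^ 2) with (i1 * i1) by ring.
      apply Rmult_le_compat; lra. }
    assert (S2 : 0 <= i2 ^ 2 <= w).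
    { split; [apply pow2_ge_0|]; rewrite <- Hww; replace (i2 ^ 2) with (i2 * i2) by ring.
      apply Rmult_le_compat; lra. }
    assert (Z1 : kap <= m * gap).
    { apply Rle_trans with (m * (r * (1 - p))); [lra|apply Rmult_le_compat_l; lra]. }
    assert (Z2 : Rabs (beta * lam * (r * (1 - r ^ 2) * i1 ^ 2)) <= B * lam * (1 * w)).
    { apply Rabs_mult_le; [apply Rabs_mult_le; [exact Hbeta|apply Rabs_le; lra]|].
      apply Rabs_mult_le; apply Rabs_le; lra. }
    assert (Z3 : Rabs (p * r * (1 - (p * r) ^ 2) * i2 ^ 2) <= 1 * w).
    { apply Rabs_mult_le; apply Rabs_le; lra. }
    apply Rabs_le_between in Z2; apply Rabs_le_between in Z3.
    assert (Z4 : 2 * (B + 1) * w <= kap * lam).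
    { apply Rle_trans with (kap * Lam2); [right; unfold Lam2; field; lra|].
      apply Rmult_le_compat_l; lra. }
    assert (Z5 : lam ^ 3 * kap <= lam ^ 3 * (m * gap)) by (apply Rmult_le_compat_l; lra).
    assert (Z6 : 2 * (B + 1) * w * lam <= kap * lam ^ 3).
    { apply Rle_trans with (kap * lam * lam); [apply Rmult_le_compat_r; lra|].
      replace (kap * lam * lam) with (kap * lam ^ 2 * 1) by ring.
      replace (kap * lam ^ 3) with (kap * lam ^ 2 * lam) by ring.
      apply Rmult_le_compat_l; [apply Rmult_le_pos; [lra|apply pow2_ge_0]|lra]. }
    assert (Z7 : c <= kap / 8) by exact Hck8.
    assert (Z8 : c * lam ^ 3 <= kap / 8 * lam ^ 3) by (apply Rmult_le_compat_r; lra).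
    assert (Z9 : w <= w * lam) by (rewrite Rmult_comm; apply le_scale_up; lra).
    assert (Z10 : 0 <= B * w * lam) by (repeat apply Rmult_le_pos; lra).
    lra.
  - assert (D := phase_speed_saddle p r m lam beta 0 ltac:(lra) ltac:(lra) ltac:(lra) ltac:(lra)).
    destruct (Hd 0 ltac:(lra)) as [[D1 D2] [I1 I2]]; specialize (D D1 D2).
    fold x M in D.
    set (i1 := / dist2 r 0) in *; set (i2 := / dist2 (p * r) 0) in *.
    assert (0 <= (p * r * (1 - 0) - (p * r) ^ 2) * i2) by (apply Rmult_le_pos; lra).
    assert (Z2 : Rabs (beta * (r * / (1 - r)) * lam) <= B * (1 * / h) * lam).
    { apply Rabs_mult_le; [|apply Rabs_le; lra].
      apply Rabs_mult_le; [exact Hbeta|apply Rabs_mult_le; apply Rabs_le; lra]. }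
    apply Rabs_le_between in Z2; unfold Rdiv in D.
    assert (B * (1 * / h) * lam <= C * lam).
    { apply Rmult_le_compat_r; [lra|].
      assert (B * / h <= B * w) by (apply Rmult_le_compat_l; lra).
      unfold C; lra. }
    lra.
  - intros s Hs; destruct (Hd s Hs) as [[D1 D2] [I1 I2]].
    rewrite Hk3; unfold x, M; rewrite phase_speed_saddle by lra.
    set (i1 := / dist2 r s) in *; set (i2 := / dist2 (p * r) s) in *.
    replace (p * r * (1 - (p * r) ^ 2) * / (1 - p * r) ^ 2)
      with (p * r * (1 + p * r) * / (1 - p * r)) by (field; lra).
    replace (r * (1 - r ^ 2) * / (1 - r) ^ 2) with (r * (1 + r) * / (1 - r)) by (field; lra).
    assert (Z4 : 0 <= lam ^ 3 * s ^ 2) by (apply Rmult_le_pos; [lra|apply pow2_ge_0]).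
    assert (V1 : 0 <= p * r * (1 + p * r) * / (1 - p * r) * i2 <= 2 * w).
    { assert (0 <= p * r * (1 + p * r) <= 2) by lra.
      assert (0 <= / (1 - p * r) * i2 <= w) by (rewrite <- Hww; split; [apply Rmult_le_pos; lra|apply Rmult_le_compat; lra]).
      rewrite Rmult_assoc; split; [apply Rmult_le_pos; lra|apply Rmult_le_compat; lra]. }
    assert (V2 : 0 <= r * (1 + r) * / (1 - r) * i1 <= 2 * w).
    { assert (0 <= r * (1 + r) <= 2) by lra.
      assert (0 <= / (1 - r) * i1 <= w) by (rewrite <- Hww; split; [apply Rmult_le_pos; lra|apply Rmult_le_compat; lra]).
      rewrite Rmult_assoc; split; [apply Rmult_le_pos; lra|apply Rmult_le_compat; lra]. }
    assert (V3 : 0 <= 2 * r ^ 2 * / (1 - r) * i1 <= 2 * w).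
    { assert (0 <= 2 * r ^ 2 <= 2) by lra.
      assert (0 <= / (1 - r) * i1 <= w) by (rewrite <- Hww; split; [apply Rmult_le_pos; lra|apply Rmult_le_compat; lra]).
      rewrite Rmult_assoc; split; [apply Rmult_le_pos; lra|apply Rmult_le_compat; lra]. }
    assert (V4 : 0 <= r * i1 <= w) by (split; [apply Rmult_le_pos; lra|]; apply Rle_trans with (1 * w); [apply Rmult_le_compat; lra|lra]).
    apply Rle_trans with (lam ^ 3 * s ^ 2 * m2 * 2 * (2 * w) + B * lam * s * (3 * w) + 2 * w).
    + apply Rabs_plus_le; [apply Rabs_minus_le|].
      * apply Rabs_mult_le; [|apply Rabs_le; lra].
        apply Rabs_mult_le; [|apply Rabs_le; lra].
        apply Rabs_mult_le; apply Rabs_le; lra.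
      * apply Rabs_mult_le; [|apply Rabs_le; lra].
        apply Rabs_mult_le; [|apply Rabs_le; lra].
        apply Rabs_mult_le; [exact Hbeta|apply Rabs_le; lra].
      * apply Rabs_mult_le; apply Rabs_le; [|lra].
        assert (Z0 : 0 <= p * r * s <= 1 * 2)
          by (split; [apply Rmult_le_pos|apply Rmult_le_compat]; lra).
        lra.
    + unfold C.
      assert (Y1 : 0 <= lam ^ 3 * s ^ 2 * w) by (apply Rmult_le_pos; lra).
      assert (Y2 : 0 <= lam * s) by (apply Rmult_le_pos; lra).
      assert (Y4 : 0 <= m2 * w) by nra.
      assert (Y3 : 0 <= B * w) by nra.
      assert (Y5 : 0 <= lam * s * w) by (apply Rmult_le_pos; lra).
      assert (Y6 : 0 <= B * w * (lam ^ 3 * s ^ 2)) by (apply Rmult_le_pos; lra).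
      assert (Y7 : 0 <= m2 * w * (lam ^ 3 * s ^ 2)) by (apply Rmult_le_pos; lra).
      assert (Y8 : 0 <= m2 * w * (lam * s)) by (apply Rmult_le_pos; lra).
      assert (Y9 : 0 <= B * w * (lam * s)) by (apply Rmult_le_pos; lra).
      lra.
Qed.

(** * The parameters in terms of z *)

Lemma U0_sqr : forall p q z, 0 < p -> 0 < q -> 0 < z < 1 ->
  0 < U0 p q z /\ z * U0 p q z ^ 2 = p * q * (1 - z).
Proof.
  intros p q z Hp Hq Hz.
  assert (H : 0 < p * q * (1 - z) / z)
    by (apply Rdiv_lt_0_compat; [repeat apply Rmult_lt_0_compat|]; lra).
  split; [apply sqrt_lt_R0, H|].
  unfold U0; rewrite pow2_sqrt by lra; field; lra.
Qed.

Lemma U0_gt_q : forall p q z, 0 < p -> 0 < q -> p + q = 1 -> 0 < z < p -> q < U0 p q z.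
Proof.
  intros p q z Hp Hq Hpq Hz.
  destruct (U0_sqr p q z Hp Hq ltac:(lra)) as [HU E].
  destruct (Rlt_le_dec q (U0 p q z)) as [H|H]; [exact H|exfalso].
  set (U := U0 p q z) in *.
  assert (U ^ 2 <= q ^ 2) by (apply pow_incr; lra).
  assert (z * U ^ 2 <= z * q ^ 2) by (apply Rmult_le_compat_l; lra).
  assert (q * (p * (1 - z) - z * q) > 0) by (apply Rmult_lt_0_compat; nra).
  nra.
Qed.

Lemma U0_decreasing : forall p q z z', 0 < p -> 0 < q -> 0 < z <= z' -> z' < 1 ->
  U0 p q z' <= U0 p q z.
Proof.
  intros p q z z' Hp Hq Hz Hz'; unfold U0; apply sqrt_le_1_alt.
  assert (0 < p * q) by (apply Rmult_lt_0_compat; assumption).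
  unfold Rdiv; apply Rmult_le_compat;
    [apply Rmult_le_pos; lra| |apply Rmult_le_compat_l; lra|].
  - apply Rlt_le, Rinv_0_lt_compat; lra.
  - apply Rinv_le_contravar; lra.
Qed.

Lemma Rpower_cube_root : forall a, 0 < a -> Rpower a (1 / 3) ^ 3 = a.
Proof.
  intros a Ha; rewrite <- Rpower_pow by apply exp_pos; rewrite Rpower_mult.
  replace (1 / 3 * INR 3) with 1 by (simpl; field); apply Rpower_1, Ha.
Qed.

Lemma Rpower_two_thirds : forall a, Rpower a (2 / 3) = Rpower a (1 / 3) ^ 2.
Proof.
  intros a; rewrite <- Rpower_pow by apply exp_pos; rewrite Rpower_mult.
  f_equal; simpl; field.
Qed.

Lemma Rpower_inv_cube : forall lam, 0 < lam -> Rpower (/ lam ^ 3) (1 / 3) = / lam.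
Proof.
  intros lam Hl; unfold Rpower; rewrite ln_Rinv, ln_pow by (assumption || apply pow_lt, Hl).
  replace (1 / 3 * - (INR 3 * ln lam)) with (- ln lam) by (simpl; field).
  rewrite exp_Ropp, exp_ln by exact Hl; reflexivity.
Qed.

(** The constant k whose cube is three times the cubic coefficient of the
    phase at the saddle. *)
Definition airy_scale (p q z : R) : R :=
  (U0 p q z + p) / U0 p q z * sqrt (z * U0 p q z) * Rpower (Theta p q z) (1 / 3).

(** The third identity turns beta/(k (U0 - q)), the argument of Ai coming
    from the saddle, into Theta^(2/3) beta; the last one turns the prefactor
    (U0 + p)/(k U0) into that of the amplitude. *)
Lemma airy_scale_facts : forall p q z, 0 < p -> 0 < q -> p + q = 1 -> 0 < z < p ->
  let U := U0 p q z in let k := airy_scale p q z in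
  0 < k /\ k ^ 3 = z * (U + p) ^ 2 / (U * (U - q)) /\
  k * Rpower (Theta p q z) (2 / 3) = / (U - q) /\
  k * (Rpower (Theta p q z) (- (1 / 3)) / sqrt (z * U)) = (U + p) / U.
Proof.
  intros p q z Hp Hq Hpq Hz U k.
  assert (HU := U0_gt_q p q z Hp Hq Hpq Hz).
  fold U in HU.
  assert (Hs : 0 < sqrt (z * U)) by (apply sqrt_lt_R0, Rmult_lt_0_compat; lra).
  assert (Hs2 : sqrt (z * U) ^ 2 = z * U) by (apply pow2_sqrt, Rmult_le_pos; lra).
  assert (Hss : sqrt (z * U) * sqrt (U / z) = U).
  { rewrite <- sqrt_mult_alt by (apply Rmult_le_pos; lra).
    replace (z * U * (U / z)) with (U ^ 2) by (field; lra). apply sqrt_pow2; lra. }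
  assert (HT : 0 < Theta p q z).
  { unfold Theta; fold U; apply Rmult_lt_0_compat.
    - apply sqrt_lt_R0, Rdiv_lt_0_compat; lra.
    - apply Rinv_0_lt_compat, Rmult_lt_0_compat; lra. }
  assert (HT3 := Rpower_cube_root _ HT).
  assert (HTp : 0 < Rpower (Theta p q z) (1 / 3)) by apply exp_pos.
  rewrite Rpower_Ropp, Rpower_two_thirds; unfold k, airy_scale; fold U.
  set (t := Rpower (Theta p q z) (1 / 3)) in *; set (s := sqrt (z * U)) in *.
  assert (Hst : s * t ^ 3 = U / ((U + p) * (U - q))).
  { rewrite HT3; unfold Theta; fold U.
    transitivity (s * sqrt (U / z) * / ((U + p) * (U - q))); [ring|rewrite Hss; reflexivity]. }
  split; [|split; [|split]].
  - repeat apply Rmult_lt_0_compat; try lra; apply Rinv_0_lt_compat; lra.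
  - transitivity ((U + p) ^ 3 / U ^ 3 * s ^ 2 * (s * t ^ 3)); [field; lra|].
    rewrite Hst, Hs2; field; lra.
  - transitivity ((U + p) / U * (s * t ^ 3)); [ring|].
    rewrite Hst; field; lra.
  - field; lra.
Qed.

Lemma exp_INR_mult : forall n a, exp (INR n * a) = exp a ^ n.
Proof.
  intros n a; induction n as [|n IH]; [simpl; rewrite Rmult_0_l; apply exp_0|].
  rewrite S_INR, Rmult_plus_distr_r, Rmult_1_l, exp_plus, IH; simpl; ring.
Qed.

Definition exponent (p q z beta lam : R) : R :=
  lam ^ 3 * ((z - 1) * ln (U0 p q z) + Yminus p q z * ln (U0 p q z - q)
             + (1 - Yminus p q z) * ln (U0 p q z + p))
  + ln ((U0 p q z + p) / (U0 p q z - q)) * beta * lam.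

Definition real_amplitude (p q z beta lam : R) : R :=
  exp (exponent p q z beta lam) / lam
  * (Rpower (Theta p q z) (- (1 / 3)) / sqrt (z * U0 p q z)).

(** The imaginary part of psi0/eps is PI z N = PI n, so the amplitude is real
    with sign (-1)^n. *)
Lemma amplitude_real : forall p q z beta lam N n, 0 < lam -> lam ^ 3 = INR N -> INR n = z * INR N ->
  amplitude p q z beta (/ INR N) = RtoC ((-1) ^ n * real_amplitude p q z beta lam).
Proof.
  intros p q z beta lam N n Hl HN Hn.
  assert (Hc : Rpower (/ INR N) (1 / 3) = / lam).
  { rewrite <- HN; apply Rpower_inv_cube, Hl. }
  unfold amplitude, Cexp, psi0, real_amplitude.
  rewrite Rpower_Ropp, Hc, !Rinv_inv.
  assert (Him : INR N * (z * PI) = INR n * PI) by (rewrite Hn; ring).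
  set (Rest := Rpower (Theta p q z) (- (1 / 3)) / sqrt (z * U0 p q z)).
  set (Ex := exponent p q z beta lam).
  apply injective_projections; unfold RtoC, Cplus, Cmult, Ci, Re, Im; simpl fst; simpl snd.
  - match goal with |- context [exp ?e] => replace e with Ex end.
    2:{ unfold Ex, exponent; rewrite HN; ring. }
    match goal with |- context [cos ?e] => replace e with (INR n * PI) end.
    2:{ rewrite <- Him; ring. }
    rewrite cos_INR_PI; field; lra.
  - match goal with |- context [sin ?e] => replace e with (INR n * PI) end.
    2:{ rewrite <- Him; ring. }
    rewrite sin_INR_PI; ring.
Qed.

(** The choice r = 1/(U0 + p), m = z (U0 + p)/q turns the leading exponents of
    [saddle_x], [saddle_M] and [saddle_n] into N Yminus, N (1 - z) and N z, and
    r^(-n) times the value of the integrand at the saddle into the exponential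
    of the amplitude.  The factor (U0 + p)/U0 comes from the extra 1 in M. *)
Lemma krawtchouk_saddle_form : forall p q z beta lam N n,
  0 < p -> 0 < q -> p + q = 1 -> 0 < z < p -> 0 < lam ->
  lam ^ 3 = INR N -> INR n = z * INR N ->
  let U := U0 p q z in let r := / (U + p) in let m := z * (U + p) / q in
  let x := saddle_x r m lam beta in let M := saddle_M p r m lam in
  x = (Yminus p q z - beta * Rpower (/ INR N) (2 / 3)) * INR N /\
  (-1) ^ n * krawtchouk n x N p q
  = exp (exponent p q z beta lam) * ((U + p) / U) *
    (exp (- log_amplitude x M p r 0)
     * RInt (contour_integrand x M (saddle_n p r m lam) p r) 0 PI / PI).
Proof.
  intros p q z beta lam N n Hp Hq Hpq Hz Hl HN Hn U r m x M.
  assert (HUq := U0_gt_q p q z Hp Hq Hpq Hz).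
  destruct (U0_sqr p q z Hp Hq ltac:(lra)) as [HU0 HU2].
  fold U in HUq, HU0, HU2.
  assert (Hl3 : 0 < lam ^ 3) by (apply pow_lt, Hl).
  assert (Hr : 0 < r < 1).
  { unfold r; split; [apply Rinv_0_lt_compat; lra|].
    rewrite <- Rinv_1; apply Rinv_lt_contravar; lra. }
  assert (Ex : x = lam ^ 3 * Yminus p q z - beta * lam).
  { unfold x, saddle_x; do 2 f_equal.
    transitivity (z * U ^ 2 / q - 2 * z * U + z * q).
    - unfold m, r; replace p with (1 - q) by lra; field; lra.
    - rewrite HU2; unfold Yminus; fold U; replace p with (1 - q) by lra; field; lra. }
  assert (EM : M = INR N - INR n + 1).
  { rewrite Hn, <- HN; unfold M, saddle_M.
    transitivity (lam ^ 3 * (z * U ^ 2 / (p * q)) + 1); [unfold m, r; field; lra|].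
    rewrite HU2; field; lra. }
  assert (En : saddle_n p r m lam = INR n).
  { rewrite Hn, <- HN; unfold saddle_n, m, r; replace (1 - p) with q by lra; field; lra. }
  assert (Hc : Rpower (/ INR N) (1 / 3) = / lam).
  { rewrite <- HN; apply Rpower_inv_cube, Hl. }
  split.
  { rewrite Ex, Rpower_two_thirds, Hc, <- HN; field; lra. }
  assert (HK := krawtchouk_contour_integral n N x p q r ltac:(lra) Hpq Hr).
  rewrite <- EM, <- En in HK at 1.
  rewrite HK.
  assert (El : log_amplitude x M p r 0
     = x * (ln (U - q) - ln (U + p)) - M * (ln U - ln (U + p))).
  { unfold log_amplitude, dist2; rewrite !Rmult_0_r, !Rplus_0_r.
    rewrite !ln_pow by nra.
    replace (1 - r) with ((U - q) / (U + p)) by (unfold r; replace p with (1 - q) by lra; field; lra).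
    replace (1 - p * r) with (U / (U + p)) by (unfold r; field; lra).
    rewrite !ln_div by lra; simpl INR; field. }
  assert (Hrn : (- r) ^ n = (-1) ^ n * exp (- (INR n * ln (U + p)))).
  { replace (- r) with (-1 * r) by ring; rewrite Rpow_mult_distr; f_equal.
    rewrite <- Ropp_mult_distr_r_reverse, exp_INR_mult, exp_Ropp, exp_ln by lra; reflexivity. }
  assert (Hsgn : (-1) ^ n * (-1) ^ n = 1).
  { rewrite <- Rpow_mult_distr; replace (-1 * -1) with 1 by ring; apply pow1. }
  rewrite Hrn, El.
  assert (Hexp : exp (exponent p q z beta lam) * ((U + p) / U)
     * (exp (- (x * (ln (U - q) - ln (U + p)) - M * (ln U - ln (U + p)))) * exp (- (INR n * ln (U + p)))) = 1).
  { replace ((U + p) / U) with (exp (ln (U + p) - ln U))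
      by (unfold Rminus; rewrite exp_plus, exp_Ropp, !exp_ln by lra; reflexivity).
    rewrite <- !exp_plus, <- exp_0; f_equal.
    unfold exponent; fold U; rewrite ln_div by lra.
    rewrite EM, Ex, Hn, <- HN; ring. }
  assert (HP := PI_neq0).
  transitivity ((-1) ^ n * krawtchouk n x N p q * 1); [ring|].
  rewrite <- Hexp; field; lra.
Qed.

Theorem mainTheorem8 :
  forall (p q : R), 0 < p < 1 -> 0 < q < 1 -> p + q = 1 ->
  forall (z1 z2 B delta eta : R),
    0 < z1 -> z2 < p -> 0 < delta -> 0 < eta ->
  exists N0 : nat,
  forall (N n : nat) (eps x y z beta : R),
    (N0 <= N)%nat ->
    eps = / INR N ->
    x = y * INR N ->
    INR n = z * INR N ->
    y = Yminus p q z - beta * Rpower eps (2 / 3) ->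
    z1 <= z <= z2 ->
    Rabs beta <= B ->
    let K := RtoC (krawtchouk n x N p q) in
    let A := amplitude p q z beta eps in
    let a := Airy (Rpower (Theta p q z) (2 / 3) * beta) in
    Cmod (Cminus K (Cmult A (RtoC a))) <= eta * Cmod A
    /\ (delta <= Rabs a ->
        Cmod (Cminus (Cdiv K (Cmult A (RtoC a))) (RtoC 1)) <= eta).
Proof.
  intros p q Hp Hq Hpq z1 z2 B delta eta Hz1 Hz2 Hdelta Heta.
  destruct (Rlt_le_dec z2 z1) as [H12|H12].
  { exists O; intros N n eps x y z beta _ _ _ _ _ Hz; exfalso; lra. }
  set (U1 := U0 p q z1); set (U2 := U0 p q z2).
  assert (HU2 : q < U2) by (apply U0_gt_q; lra).
  assert (HU12 : U2 <= U1) by (apply U0_decreasing; lra).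
  set (Q := (U1 + p) ^ 2 / (U2 * (U2 - q))).
  assert (HD : 0 < U2 * (U2 - q)) by (apply Rmult_lt_0_compat; lra).
  assert (HQ : 0 < Q) by (apply Rdiv_lt_0_compat; [apply pow_lt; lra|exact HD]).
  (* Q bounds k^3, hence k <= 1 + Q for the factor k by which the error of the
     integral is multiplied; Rmin 1 delta serves both conclusions. *)
  set (e := eta * Rmin 1 delta / (1 + Q)).
  assert (Hmin : 0 < Rmin 1 delta) by (apply Rmin_glb_lt; lra).
  assert (He : 0 < e) by (apply Rdiv_lt_0_compat; [apply Rmult_lt_0_compat; lra|lra]).
  destruct (saddle_asymptotics p (/ (U1 + p)) (/ (U2 + p)) (z1 / q) ((U1 + p) / q) (Rabs B) e)
    as [Lam [HLam HA]]; try assumption.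
  { apply Rinv_0_lt_compat; lra. }
  { rewrite <- Rinv_1; apply Rinv_lt_contravar; lra. }
  { apply Rdiv_lt_0_compat; lra. }
  { apply Rabs_pos. }
  destruct (nfloor_ex (Lam ^ 3)) as [N1 HN1]; [apply pow_le; lra|].
  exists (S N1); intros N n eps x y z beta HN -> Hx Hn Hy Hz Hbeta K A a.
  set (lam := Rpower (INR N) (1 / 3)).
  assert (HN0 : Lam ^ 3 <= INR N).
  { apply le_INR in HN; rewrite S_INR in HN; lra. }
  assert (HNpos : 0 < INR N) by (apply Rlt_le_trans with (Lam ^ 3); [apply pow_lt|]; lra).
  assert (Hl : 0 < lam) by apply exp_pos.
  assert (Hl3 : lam ^ 3 = INR N) by (apply Rpower_cube_root, HNpos).
  assert (HLl : Lam <= lam).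
  { destruct (Rle_lt_dec Lam lam) as [H|H]; [exact H|exfalso].
    assert (lam ^ 2 <= Lam ^ 2) by (apply pow_incr; lra).
    assert (lam ^ 3 < Lam ^ 3); [|lra].
    replace (lam ^ 3) with (lam ^ 2 * lam) by ring.
    replace (Lam ^ 3) with (Lam ^ 2 * Lam) by ring.
    apply Rle_lt_trans with (Lam ^ 2 * lam); [apply Rmult_le_compat_r; lra|].
    apply Rmult_lt_compat_l; [apply pow_lt; lra|exact H]. }
  assert (Hzp : 0 < z < p) by lra.
  destruct (airy_scale_facts p q z) as [Hk [Hk3 [Hk2 Hk1]]]; try lra.
  destruct (krawtchouk_saddle_form p q z beta lam N n) as [Ex EK]; try lra.
  rewrite <- Hy, <- Hx in Ex; rewrite Ex in EK.
  assert (EA := amplitude_real p q z beta lam N n Hl Hl3 Hn).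
  set (U := U0 p q z) in *; set (k := airy_scale p q z) in *.
  set (r := / (U + p)) in *; set (m := z * (U + p) / q) in *.
  assert (HUl : U2 <= U) by (apply U0_decreasing; lra).
  assert (HUu : U <= U1) by (apply U0_decreasing; lra).
  set (size := real_amplitude p q z beta lam) in *.
  set (J := exp (- log_amplitude x (saddle_M p r m lam) p r 0)
     * RInt (contour_integrand x (saddle_M p r m lam) (saddle_n p r m lam) p r) 0 PI) in *.
  assert (HJ : Rabs (lam * J - / k * (PI * a)) <= e).
  { assert (Eb : beta * (r / (1 - r)) / k = Rpower (Theta p q z) (2 / 3) * beta).
    { replace (Rpower (Theta p q z) (2 / 3)) with (/ (U - q) / k) by (rewrite <- Hk2; field; lra).
      unfold r; replace p with (1 - q) by lra; field; repeat split; lra. }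
    unfold a; rewrite <- Eb; unfold J; rewrite <- Ex.
    apply HA; try assumption.
    - unfold r; split; apply Rinv_le_contravar; lra.
    - unfold m, Rdiv; split.
      + apply Rmult_le_compat_r; [apply Rlt_le, Rinv_0_lt_compat; lra|].
        apply Rle_trans with (z * 1); [lra|apply Rmult_le_compat_l; lra].
      + apply Rmult_le_compat_r; [apply Rlt_le, Rinv_0_lt_compat; lra|].
        apply Rle_trans with (1 * (U + p)); [apply Rmult_le_compat_r; lra|lra].
    - apply Rle_trans with (1 := Hbeta), Rle_abs.
    - rewrite Hk3; unfold m, r; replace (1 - p) with q by lra.
      replace p with (1 - q) by lra; field; repeat split; lra. }
  assert (HkQ : k <= 1 + Q).
  { destruct (Rle_lt_dec k (1 + Q)) as [H|H]; [exact H|exfalso].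
    assert (k ^ 3 <= Q).
    { rewrite Hk3; unfold Q, Rdiv; apply Rmult_le_compat.
      - apply Rmult_le_pos; [lra|apply pow2_ge_0].
      - apply Rlt_le, Rinv_0_lt_compat, Rmult_lt_0_compat; lra.
      - assert ((U + p) ^ 2 <= (U1 + p) ^ 2) by (apply pow_incr; lra).
        assert (0 <= (U + p) ^ 2) by apply pow2_ge_0.
        apply Rle_trans with (1 * (U + p) ^ 2); [apply Rmult_le_compat_r|]; lra.
      - apply Rinv_le_contravar; [exact HD|apply Rmult_le_compat; lra]. }
    clearbody k Q; clear - H H0 HQ; assert (1 < k ^ 2) by nra; nra. }
  assert (HS : 0 < size).
  { unfold size, real_amplitude; fold U; apply Rmult_lt_0_compat.
    - apply Rdiv_lt_0_compat; [apply exp_pos|exact Hl].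
    - apply Rdiv_lt_0_compat; [apply exp_pos|apply sqrt_lt_R0, Rmult_lt_0_compat; lra]. }
  set (sg := (-1) ^ n) in *.
  assert (Hsg : sg * sg = 1).
  { unfold sg; rewrite <- Rpow_mult_distr; replace (-1 * -1) with 1 by ring; apply pow1. }
  assert (Hsa : Rabs sg = 1).
  { unfold sg; rewrite <- RPow_abs, Rabs_left by lra; replace (- (-1)) with 1 by ring; apply pow1. }
  set (Kr := krawtchouk n x N p q) in *.
  assert (HP := PI_RGT_0).
  assert (HP1 : 1 < PI) by (assert (X := PI2_1); lra).
  assert (Main : Rabs (Kr - sg * size * a) <= eta * Rmin 1 delta * size).
  { assert (E : Kr - sg * size * a = sg * (size * (k / PI * (lam * J - / k * (PI * a))))).
    { transitivity (sg * (sg * Kr) - sg * size * a).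
      - rewrite <- Rmult_assoc, Hsg; ring.
      - rewrite EK, <- Hk1; unfold size, real_amplitude; fold U; field.
        repeat split; try lra; apply Rgt_not_eq, sqrt_lt_R0, Rmult_lt_0_compat; lra. }
    rewrite E, !Rabs_mult, Hsa, Rmult_1_l, (Rabs_pos_eq size) by lra.
    rewrite Rmult_comm; apply Rmult_le_compat_r; [lra|].
    assert (Hkp : 0 < k / PI <= 1 + Q).
    { split; [apply Rdiv_lt_0_compat; lra|].
      apply Rle_trans with (k * 1); [|lra]; unfold Rdiv; apply Rmult_le_compat_l; [lra|].
      rewrite <- Rinv_1; apply Rinv_le_contravar; lra. }
    rewrite (Rabs_pos_eq (k / PI)) by lra.
    apply Rle_trans with ((1 + Q) * e); [|right; unfold e; field; lra].
    apply Rmult_le_compat; [lra|apply Rabs_pos|lra|exact HJ]. }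
  assert (EAc : A = RtoC (sg * size)) by exact EA.
  assert (HcA : Cmod A = size).
  { rewrite EAc, Cmod_R, Rabs_mult, Hsa, Rabs_pos_eq; lra. }
  split.
  - rewrite HcA, EAc; unfold K; rewrite <- RtoC_mult, <- RtoC_minus, Cmod_R.
    eapply Rle_trans; [exact Main|]; apply Rmult_le_compat_r; [lra|].
    assert (Hm1 : Rmin 1 delta <= 1) by apply Rmin_l.
    apply Rle_trans with (eta * 1); [apply Rmult_le_compat_l|]; lra.
  - intros Hda.
    assert (Ha0 : a <> 0) by (intros H0; rewrite H0, Rabs_R0 in Hda; lra).
    assert (Hsg0 : sg <> 0) by (intros H0; rewrite H0 in Hsg; lra).
    assert (Hne : sg * size * a <> 0)
      by (apply Rmult_integral_contrapositive_currified;
          [apply Rmult_integral_contrapositive_currified; [exact Hsg0|lra]|exact Ha0]).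
    rewrite EAc; unfold K; rewrite <- RtoC_mult, <- RtoC_div, <- RtoC_minus, Cmod_R by exact Hne.
    assert (HSn : size <> 0) by lra.
    replace (Kr / (sg * size * a) - 1) with ((Kr - sg * size * a) * / (sg * size * a)) by (field; auto).
    assert (Habs : Rabs (sg * size * a) = size * Rabs a).
    { rewrite !Rabs_mult, Hsa, (Rabs_pos_eq size); lra. }
    rewrite Rabs_mult, Rabs_inv, Habs.
    assert (HSa : 0 < size * Rabs a) by (apply Rmult_lt_0_compat; lra).
    apply Rmult_le_reg_r with (size * Rabs a); [exact HSa|].
    rewrite Rmult_assoc, Rinv_l, Rmult_1_r by lra.
    eapply Rle_trans; [exact Main|].
    assert (Hmd : Rmin 1 delta <= delta) by apply Rmin_r.
    replace (eta * Rmin 1 delta * size) with (eta * size * Rmin 1 delta) by ring.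
    replace (eta * (size * Rabs a)) with (eta * size * Rabs a) by ring.
    apply Rmult_le_compat_l; [apply Rmult_le_pos|]; lra.
Qed.
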